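(* Let $n \geq 1$ be an integer, let $f : \mathbb{R} \to \mathbb{R}$ be continuous, and let $e : \mathbb{R} \to \mathbb{R}$ be continuous with $e(t+2\pi) = e(t)$ for all $t$. Let $F(x) = \int_0^x f(t)\,dt$. Assume that the limits $F(\infty) = \lim_{x \to \infty} F(x)$ and $F(-\infty) = \lim_{x \to -\infty} F(x)$ exist and are finite, and that $F(-\infty) < F(x) < F(\infty)$ for all $x \in \mathbb{R}$. Define $$A_n = \int_0^{2\pi} e(t) \cos nt \, dt, \qquad B_n = \int_0^{2\pi} e(t) \sin nt \, dt .$$ Then the condition $$\sqrt{A_n^2 + B_n^2} < 2n \left( F(\infty) - F(-\infty) \right)$$ is necessary and sufficient for the existence of a $2\pi$-periodic solution $x = x(t)$ of the equation $$x'' + f(x) x' + n^2 x = e(t).$$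
   Context: A $2\pi$-periodic solution is a twice continuously differentiable function $x : \mathbb{R} \to \mathbb{R}$ satisfying the differential equation for all $t$ and $x(t+2\pi) = x(t)$ for all $t$. *)

(* Defs.v *)
From Stdlib Require Import Reals.
From Coquelicot Require Import Coquelicot.
Open Scope R_scope.

Definition int_from_0 (f : R -> R) (x : R) : R := RInt f 0 x.

Definition cos_coeff (e : R -> R) (n : nat) : R :=
  RInt (fun t => e t * cos (INR n * t)) 0 (2 * PI).

Definition sin_coeff (e : R -> R) (n : nat) : R :=
  RInt (fun t => e t * sin (INR n * t)) 0 (2 * PI).

(* [Derive] is total, so the existence of each derivative is required
   separately. *)
Definition twice_continuously_differentiable (x : R -> R) : Prop :=
  (forall t : R, ex_derive x t) /\
  (forall t : R, ex_derive (Derive x) t) /\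
  (forall t : R, continuous (Derive (Derive x)) t).

Definition periodic_2PI (x : R -> R) : Prop :=
  forall t : R, x (t + 2 * PI) = x t.

Definition periodic_solution (n : nat) (f e x : R -> R) : Prop :=
  twice_continuously_differentiable x /\
  (forall t : R,
     Derive (Derive x) t + f (x t) * Derive x t + INR n ^ 2 * x t = e t) /\
  periodic_2PI x.

(* Main.v *)
Require Import Defs.
From Stdlib Require Import Reals ZArith Lra Lia Bool IndefiniteDescription.
From Coquelicot Require Import Coquelicot.
Open Scope R_scope.

(** Necessity: testing the equation against the two solutions of x'' + n^2 x = 0
    gives A_n = n int F(x) sin nt and B_n = - n int F(x) cos nt; since F(x(t)) stays
    in a compact part of (F(-oo), F(oo)) and int |a cos nt + b sin nt| = 4 |(a, b)|,
    the strict inequality follows.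

    Sufficiency: write x = a cos nt + b sin nt with a' = - F(x) cos nt - (e/n) sin nt
    and b' = - F(x) sin nt + (e/n) cos nt.  As the unperturbed equation has period
    2 pi, the displacement z(2 pi) - z(0) of z = (a, b) is bounded.  On large circles
    F(x(t)) is close to F(oo) or F(-oo) according to the sign of the unperturbed
    solution, so <z(0), z(2 pi) - z(0)> <= - (2 (F(oo) - F(-oo)) - sqrt(A_n^2 + B_n^2) / n - eps) |z(0)| + C
    is negative.  A planar vector field which points inward on a circle has a zero
    inside, and this zero is the initial value of a periodic solution. *)

(** As f is only continuous, the phase plane (x, x') need not offer a Lipschitz right-hand side from
    which uniqueness and a continuous displacement map could be read off. The coordinates (a, b) do:
    they are the Liénard pair (x, (x' + F(x)) / n) rotated by the angle nt, and only F, which is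
    C^1, enters their equations. The price is that the second derivative of x has to be recovered
    afterwards. F may still fail to be globally Lipschitz, so the system is solved with a truncated
    F. This is not circular: the drift is bounded through sup |F| and sup |e| alone, that bound
    fixes the radius of the circle, and only then is the truncation level chosen. The factor 2 in
    the condition is 4 times 1/2: the limits of F deviate from their mean by half the gap F(oo) -
    F(-oo), the mean is orthogonal to the wave, and the integral of the absolute wave supplies the
    4. The zero of the planar field is reduced to a sign condition on opposite sides of a square,
    where counting grid edges modulo 2 replaces degree theory. *)

(** * Parity on a grid and the Poincaré-Miranda theorem *)

(* Two boolean labels u, v are merged into the three colours ~u, u /\ ~v, u /\ v of
   Sperner's lemma; [grid_edge] marks the edges joining the first two colours. *)
Definition grid_edge (u v u' v' : bool) : bool :=
  (negb u && u' && negb v') || (negb u' && u && negb v).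

Fixpoint grid_row (u v : nat -> bool) (k : nat) : bool :=
  match k with
  | O => false
  | S i => xorb (grid_row u v i) (grid_edge (u i) (v i) (u (S i)) (v (S i)))
  end.

(* A closed circuit crosses an even number of marked edges unless it meets all three colours. *)
Lemma grid_cell (u1 v1 u2 v2 u3 v3 u4 v4 : bool) :
  xorb (xorb (grid_edge u1 v1 u2 v2) (grid_edge u2 v2 u3 v3))
       (xorb (grid_edge u3 v3 u4 v4) (grid_edge u4 v4 u1 v1)) = true ->
  ((u1 || u2 || u3 || u4) && negb (u1 && u2 && u3 && u4)
   && (v1 || v2 || v3 || v4) && negb (v1 && v2 && v3 && v4)) = true.
Proof.
  destruct u1, v1, u2, v2, u3, v3, u4, v4; vm_compute; easy.
Qed.

(** Summing the [k] cells of a strip modulo 2, each inner vertical edge occurs twice and cancels;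
    the two rows and the two outer vertical edges remain. [Hsym] is needed because a circuit around
    a cell runs through its upper and left edges backwards. *)
Lemma grid_row_step (u v u' v' : nat -> bool) (k : nat) :
  (forall i, (i < k)%nat ->
     xorb (xorb (grid_edge (u i) (v i) (u (S i)) (v (S i)))
                (grid_edge (u (S i)) (v (S i)) (u' (S i)) (v' (S i))))
          (xorb (grid_edge (u' (S i)) (v' (S i)) (u' i) (v' i))
                (grid_edge (u' i) (v' i) (u i) (v i))) = false) ->
  xorb (grid_row u v k) (grid_row u' v' k) =
  xorb (grid_edge (u 0%nat) (v 0%nat) (u' 0%nat) (v' 0%nat))
       (grid_edge (u k) (v k) (u' k) (v' k)).
Proof.
  assert (Hsym : forall a b c d, grid_edge a b c d = grid_edge c d a b)
    by (intros [] [] [] []; reflexivity).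
  induction k as [|k IH]; intros H.
  - simpl. now rewrite xorb_nilpotent.
  - specialize (IH (fun i Hi => H i (Nat.lt_trans _ _ _ Hi (Nat.lt_succ_diag_r k)))).
    specialize (H k (Nat.lt_succ_diag_r k)). simpl.
    rewrite (Hsym (u' (S k)) (v' (S k))), (Hsym (u' k) (v' k) (u k)) in H.
    revert H IH.
    generalize (grid_row u v k), (grid_row u' v' k),
      (grid_edge (u k) (v k) (u (S k)) (v (S k))),
      (grid_edge (u (S k)) (v (S k)) (u' (S k)) (v' (S k))),
      (grid_edge (u' k) (v' k) (u' (S k)) (v' (S k))),
      (grid_edge (u k) (v k) (u' k) (v' k)),
      (grid_edge (u 0%nat) (v 0%nat) (u' 0%nat) (v' 0%nat)).
    intros [] [] [] [] [] [] []; simpl; easy.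
Qed.

(** On the left and right sides [u] is constant, so no edge there is marked. In the bottom row,
    where [v] is false, the marked edges are the changes of [u], and these telescope from false to
    true; in the top row, where [v] is true, no edge is marked. *)
Lemma grid_sign_change (N : nat) (u v : nat -> nat -> bool)
  (Hl : forall j, u 0%nat j = false) (Hr : forall j, u N j = true)
  (Hb : forall i, v i 0%nat = false) (Ht : forall i, v i N = true) :
  exists i j, (i < N)%nat /\ (j < N)%nat /\
   (u i j || u (S i) j || u (S i) (S j) || u i (S j)) &&
   negb (u i j && u (S i) j && u (S i) (S j) && u i (S j)) &&
   (v i j || v (S i) j || v (S i) (S j) || v i (S j)) &&
   negb (v i j && v (S i) j && v (S i) (S j) && v i (S j)) = true.
Proof.
  apply Classical_Prop.NNPP; intros Hno.
  (* The parity of marked edges is the same in all rows, odd in the bottom row, even in the top row. *)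
  set (S' := fun j k => grid_row (fun i => u i j) (fun i => v i j) k).
  assert (Hbot : forall k, S' 0%nat k = u k 0%nat).
  { induction k as [|k IH]; [symmetry; apply Hl|].
    unfold S' in *; simpl. rewrite IH, !Hb.
    destruct (u k 0%nat), (u (S k) 0%nat); reflexivity. }
  assert (Htop : forall k, S' N k = false).
  { induction k as [|k IH]; [reflexivity|].
    unfold S' in *; simpl. rewrite IH, !Ht.
    destruct (u k N), (u (S k) N); reflexivity. }
  assert (Hall : forall j, (j <= N)%nat -> S' j N = true).
  { induction j as [|j IH]; intros Hj; [now rewrite Hbot|].
    assert (E : xorb (S' j N) (S' (S j) N) = false).
    { unfold S'. rewrite (grid_row_step (fun i => u i j) (fun i => v i j)).
      - cbv beta. rewrite !Hl, !Hr. unfold grid_edge. simpl. reflexivity.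
      - intros i Hi. apply not_true_is_false; intros E.
        apply grid_cell in E. apply Hno. exists i, j.
        repeat split; auto; lia. }
    rewrite IH in E by lia. destruct (S' (S j) N); easy. }
  specialize (Hall N (le_n N)). rewrite Htop in Hall. discriminate.
Qed.

Definition pos_bool (z : R) : bool := if Rlt_dec 0 z then true else false.

(** One of the four values is positive and another is not, so [z] is less than [eps] away from both
    half-lines. *)
Lemma pos_bool_mixed (a b c d : R) (eps : R) (z : R) :
  (pos_bool a || pos_bool b || pos_bool c || pos_bool d) &&
   negb (pos_bool a && pos_bool b && pos_bool c && pos_bool d) = true ->
  Rabs (a - z) < eps -> Rabs (b - z) < eps -> Rabs (c - z) < eps -> Rabs (d - z) < eps ->
  Rabs z < eps.
Proof.
  unfold pos_bool.
  destruct (Rlt_dec 0 a), (Rlt_dec 0 b), (Rlt_dec 0 c), (Rlt_dec 0 d); simpl;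
    intros H; try discriminate H; intros Ha Hb Hc Hd;
    apply Rabs_def2 in Ha, Hb, Hc, Hd; apply Rabs_def1; lra.
Qed.

Lemma pos_bool_scal (z m : R) : 0 < m -> pos_bool (z * / m) = pos_bool z.
Proof.
  intros Hm. assert (0 < / m) by now apply Rinv_0_lt_compat.
  unfold pos_bool. destruct (Rlt_dec 0 (z * / m)), (Rlt_dec 0 z); auto; exfalso; nra.
Qed.

Lemma poincare_miranda (r : R) (U V : R -> R -> R) :
  0 < r ->
  (forall x y, -r <= x <= r -> -r <= y <= r -> continuity_2d_pt U x y) ->
  (forall x y, -r <= x <= r -> -r <= y <= r -> continuity_2d_pt V x y) ->
  (forall y, -r <= y <= r -> U (-r) y < 0 < U r y) ->
  (forall x, -r <= x <= r -> V x (-r) < 0 < V x r) ->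
  exists x y, -r <= x <= r /\ -r <= y <= r /\ U x y = 0 /\ V x y = 0.
Proof.
  intros Hr HU HV HUb HVb.
  apply Classical_Prop.NNPP; intros Hno.
  (* U/m and V/m are uniformly continuous and both small at a cell where U and V change sign,
     although |U/m| + |V/m| = 1. *)
  set (m := fun x y => Rabs (U x y) + Rabs (V x y)).
  assert (Hm : forall x y, -r <= x <= r -> -r <= y <= r -> 0 < m x y).
  { intros x y Hx Hy. unfold m.
    destruct (Req_dec (U x y) 0) as [E|E].
    - destruct (Req_dec (V x y) 0) as [E'|E'].
      + exfalso; apply Hno; exists x, y; auto.
      + pose proof (Rabs_pos (U x y)). apply Rabs_pos_lt in E'. lra.
    - pose proof (Rabs_pos (V x y)). apply Rabs_pos_lt in E. lra. }
  assert (Hcm : forall x y, -r <= x <= r -> -r <= y <= r ->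
     continuity_2d_pt (fun x y => / m x y) x y).
  { intros x y Hx Hy. apply continuity_2d_pt_inv.
    - apply continuity_2d_pt_plus; apply continuity_1d_2d_pt_comp;
        auto using Rcontinuity_abs.
    - specialize (Hm x y Hx Hy). lra. }
  assert (Huc : forall W, (forall x y, -r <= x <= r -> -r <= y <= r -> continuity_2d_pt W x y) ->
     exists d : posreal, forall x y u v, -r <= x <= r -> -r <= y <= r -> -r <= u <= r -> -r <= v <= r ->
     Rabs (u - x) < d -> Rabs (v - y) < d -> Rabs (W u v * / m u v - W x y * / m x y) < /2).
  { intros W HW.
    destruct (uniform_continuity_2d (fun x y => W x y * / m x y) (-r) r (-r) r) with (eps := mkposreal (/ 2) pos_half_prf)
      as [d Hd].
    - intros x y Hx Hy. apply continuity_2d_pt_mult; auto.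
    - exists d. intros; apply Hd; auto. }
  destruct (Huc U HU) as [d1 Hd1]. destruct (Huc V HV) as [d2 Hd2].
  set (d := Rmin d1 d2).
  assert (Hd : 0 < d) by (apply Rmin_case; apply cond_pos).
  destruct (archimed_cor1 (d / (2 * r))) as [N [HN HN0]].
  { apply Rdiv_lt_0_compat; lra. }
  assert (HNp : 0 < INR N) by now apply lt_0_INR.
  (* Capping the index at [N] keeps every [p i] in [-r, r], because the boundary conditions of
     [grid_sign_change] range over all indices. *)
  set (p := fun i => - r + INR (Nat.min i N) * (2 * r * / INR N)).
  assert (Hp : forall i, -r <= p i <= r).
  { intros i. unfold p.
    assert (0 <= INR (Nat.min i N) * / INR N <= 1).
    { split.
      - apply Rmult_le_pos; [apply pos_INR | apply Rlt_le, Rinv_0_lt_compat, HNp].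
      - apply (Rmult_le_reg_r (INR N)); auto.
        rewrite Rmult_assoc, Rinv_l, Rmult_1_r, Rmult_1_l by lra.
        apply le_INR. apply Nat.le_min_r. }
    nra. }
  assert (Hp0 : p 0%nat = - r) by (unfold p; simpl; ring).
  assert (HpN : p N = r) by (unfold p; rewrite Nat.min_id; field; lra).
  assert (Hstep : forall i, (i < N)%nat -> Rabs (p (S i) - p i) < d).
  { intros i Hi. unfold p. rewrite !Nat.min_l by lia. rewrite S_INR.
    replace (_ - _) with (/ INR N * (2 * r)) by ring.
    rewrite Rabs_right.
    - apply (Rmult_lt_compat_r (2 * r)) in HN; [|lra].
      replace (d / (2 * r) * (2 * r)) with d in HN by (field; lra). exact HN.
    - apply Rle_ge, Rmult_le_pos; [apply Rlt_le, Rinv_0_lt_compat, HNp | lra]. }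
  destruct (grid_sign_change N (fun i j => pos_bool (U (p i) (p j))) (fun i j => pos_bool (V (p i) (p j))))
    as (i & j & Hi & Hj & H).
  - intros j. rewrite Hp0. unfold pos_bool. destruct (Rlt_dec _ _); auto.
    specialize (HUb (p j) (Hp j)). lra.
  - intros j. rewrite HpN. unfold pos_bool. destruct (Rlt_dec _ _); auto.
    specialize (HUb (p j) (Hp j)). lra.
  - intros j. rewrite Hp0. unfold pos_bool. destruct (Rlt_dec _ _); auto.
    specialize (HVb (p j) (Hp j)). lra.
  - intros j. rewrite HpN. unfold pos_bool. destruct (Rlt_dec _ _); auto.
    specialize (HVb (p j) (Hp j)). lra.
  - rewrite <- andb_assoc, andb_true_iff in H. destruct H as [H1 H2].
    (* Dividing by the positive [m] leaves the labels unchanged, so the cell found for U and V also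
       serves U/m and V/m, for which uniform closeness is known. *)
    rewrite <- (pos_bool_scal (U (p i) (p j)) (m (p i) (p j))),
      <- (pos_bool_scal (U (p (S i)) (p j)) (m (p (S i)) (p j))),
      <- (pos_bool_scal (U (p (S i)) (p (S j))) (m (p (S i)) (p (S j)))),
      <- (pos_bool_scal (U (p i) (p (S j))) (m (p i) (p (S j)))) in H1 by auto.
    rewrite <- (pos_bool_scal (V (p i) (p j)) (m (p i) (p j))),
      <- (pos_bool_scal (V (p (S i)) (p j)) (m (p (S i)) (p j))),
      <- (pos_bool_scal (V (p (S i)) (p (S j))) (m (p (S i)) (p (S j)))),
      <- (pos_bool_scal (V (p i) (p (S j))) (m (p i) (p (S j)))) in H2 by auto.
    assert (Hself : forall k, Rabs (p k - p k) < d)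
      by (intros; rewrite Rminus_diag, Rabs_R0; exact Hd).
    assert (D1 : d <= d1) by apply Rmin_l. assert (D2 : d <= d2) by apply Rmin_r.
    apply pos_bool_mixed with (eps := / 2) (z := U (p i) (p j) * / m (p i) (p j)) in H1;
      [| apply Hd1; auto; eapply Rlt_le_trans; eauto ..].
    apply pos_bool_mixed with (eps := / 2) (z := V (p i) (p j) * / m (p i) (p j)) in H2;
      [| apply Hd2; auto; eapply Rlt_le_trans; eauto ..].
    specialize (Hm (p i) (p j) (Hp i) (Hp j)).
    assert (Hi0 : 0 < / m (p i) (p j)) by now apply Rinv_0_lt_compat.
    rewrite Rabs_mult, (Rabs_right (/ _)) in H1, H2 by lra.
    assert (E : (Rabs (U (p i) (p j)) + Rabs (V (p i) (p j))) * / m (p i) (p j) = 1)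
      by (apply Rinv_r; lra).
    lra.
Qed.

(** * Planar fields pointing inward on a circle *)

Lemma cauchy_schwarz_2 (a b c d : R) :
  a * c + b * d <= sqrt (a ^ 2 + b ^ 2) * sqrt (c ^ 2 + d ^ 2).
Proof.
  rewrite <- sqrt_mult by nra.
  apply Rle_trans with (Rabs (a * c + b * d)); [apply Rle_abs|].
  rewrite <- sqrt_Rsqr_abs. apply sqrt_le_1_alt. unfold Rsqr.
  pose proof (pow2_ge_0 (a * d - b * c)). nra.
Qed.

(* Off the disc, (P, Q) is extended by z |-> (P, Q)(pr z) - (z - pr z) with pr the radial
   projection; at a zero z of the extension off the disc, (P, Q)(pr z) would point outward. *)
Lemma inward_zero (r K : R) (P Q : R -> R -> R) :
  0 < r ->
  (forall x y, continuity_2d_pt P x y) -> (forall x y, continuity_2d_pt Q x y) ->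
  (forall x y, Rabs (P x y) <= K /\ Rabs (Q x y) <= K) ->
  (forall x y, sqrt (x ^ 2 + y ^ 2) = r -> x * P x y + y * Q x y < 0) ->
  exists x y, sqrt (x ^ 2 + y ^ 2) <= r /\ P x y = 0 /\ Q x y = 0.
Proof.
  intros Hr HP HQ HK Hin.
  set (s := fun x y => r * / Rmax r (sqrt (x ^ 2 + y ^ 2))).
  assert (Hmax : forall x y, 0 < Rmax r (sqrt (x ^ 2 + y ^ 2)))
    by (intros; eapply Rlt_le_trans; [exact Hr | apply Rmax_l]).
  assert (Hs : forall x y, 0 < s x y <= 1).
  { intros x y. unfold s. specialize (Hmax x y). split.
    - apply Rmult_lt_0_compat; auto. now apply Rinv_0_lt_compat.
    - apply (Rmult_le_reg_r (Rmax r (sqrt (x ^ 2 + y ^ 2)))); auto.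
      rewrite Rmult_assoc, Rinv_l, Rmult_1_r, Rmult_1_l by lra. apply Rmax_l. }
  assert (Hnorm : forall x y c, 0 <= c -> sqrt ((c * x) ^ 2 + (c * y) ^ 2) = c * sqrt (x ^ 2 + y ^ 2)).
  { intros x y c Hc. replace ((c * x) ^ 2 + (c * y) ^ 2) with (Rsqr c * (x ^ 2 + y ^ 2)) by (unfold Rsqr; ring).
    rewrite sqrt_mult by (unfold Rsqr; nra). rewrite sqrt_Rsqr; auto. }
  assert (Hpr : forall x y, sqrt ((s x y * x) ^ 2 + (s x y * y) ^ 2) <= r).
  { intros x y. destruct (Hs x y). rewrite Hnorm by lra. unfold s in *. specialize (Hmax x y).
    rewrite Rmult_assoc. rewrite <- (Rmult_1_r r) at 3.
    apply Rmult_le_compat_l; [lra|].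
    apply (Rmult_le_reg_l (Rmax r (sqrt (x ^ 2 + y ^ 2)))); auto.
    rewrite <- Rmult_assoc, Rinv_r, Rmult_1_l, Rmult_1_r by lra. apply Rmax_r. }
  assert (Hfst : forall x y, Rabs x <= sqrt (x ^ 2 + y ^ 2)).
  { intros. rewrite <- sqrt_Rsqr_abs. apply sqrt_le_1_alt. unfold Rsqr; nra. }
  assert (Hsnd : forall x y, Rabs y <= sqrt (x ^ 2 + y ^ 2)).
  { intros. rewrite <- sqrt_Rsqr_abs. apply sqrt_le_1_alt. unfold Rsqr; nra. }
  assert (HK0 : 0 <= K) by (destruct (HK 0 0); pose proof (Rabs_pos (P 0 0)); lra).
  assert (Hcs : forall x y, continuity_2d_pt s x y).
  { intros x y. unfold s.
    apply continuity_2d_pt_mult; [apply continuity_2d_pt_const|].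
    apply continuity_2d_pt_inv; [|specialize (Hmax x y); lra].
    apply (continuity_1d_2d_pt_comp (fun z => Rmax r (sqrt z)) (fun x y => x ^ 2 + y ^ 2)).
    - apply continuity_pt_filterlim.
      apply (continuous_comp sqrt (Rmax r)); [apply continuous_sqrt|].
      (* The maximum is written as (r + z + |r - z|) / 2 to inherit continuity from the absolute
         value. *)
      apply (continuous_ext (fun z => / 2 * (r + z + Rabs (r - z)))).
      + intros z. unfold Rmax. destruct (Rle_dec r z).
        * rewrite Rabs_left1; lra.
        * rewrite Rabs_right; lra.
      + apply (continuous_scal_r (/2) (fun z => r + z + Rabs (r - z)) (sqrt (x ^ 2 + y ^ 2))).
        apply (continuous_plus (fun z => r + z) (fun z => Rabs (r - z))).
        * apply (continuous_plus (fun z => r) (fun z => z)); [apply continuous_const | apply continuous_id].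
        * apply continuous_Rabs_comp.
          apply (continuous_minus (fun z => r) (fun z => z)); [apply continuous_const | apply continuous_id].
    - apply continuity_2d_pt_ext with (fun x y => x * x + y * y); [intros; ring|].
      apply continuity_2d_pt_plus; apply continuity_2d_pt_mult;
        first [apply continuity_2d_pt_id1 | apply continuity_2d_pt_id2]. }
  assert (Hcomp : forall W, (forall x y, continuity_2d_pt W x y) -> forall x y,
     continuity_2d_pt (fun x y => W (s x y * x) (s x y * y)) x y).
  { intros W HW x y. apply continuity_2d_pt_filterlim.
    set (fx := fun z : R * R => s (fst z) (snd z) * fst z).
    set (fy := fun z : R * R => s (fst z) (snd z) * snd z).
    apply (continuous_comp_2 fx fy W).
    - apply (proj1 (continuity_2d_pt_filterlim (fun x y => s x y * x) x y)).
      apply continuity_2d_pt_mult; auto. apply continuity_2d_pt_id1.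
    - apply (proj1 (continuity_2d_pt_filterlim (fun x y => s x y * y) x y)).
      apply continuity_2d_pt_mult; auto. apply continuity_2d_pt_id2.
    - apply (proj1 (continuity_2d_pt_filterlim W (fx (x, y)) (fy (x, y)))). apply HW. }
  (* The projected point has coordinates at most r and the field at most K, so on the sides of this
     square the leading term, x or y, decides the sign. The extended field is negated, to be outward
     there as [poincare_miranda] demands. *)
  set (B := r + K + 1).
  destruct (poincare_miranda B
     (fun x y => x - s x y * x - P (s x y * x) (s x y * y))
     (fun x y => y - s x y * y - Q (s x y * x) (s x y * y))) as (x & y & _ & _ & Ex & Ey).
  - unfold B; lra.
  - intros x y _ _. apply continuity_2d_pt_minus; [|auto].
    apply continuity_2d_pt_minus; [apply continuity_2d_pt_id1|].
    apply continuity_2d_pt_mult; auto. apply continuity_2d_pt_id1.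
  - intros x y _ _. apply continuity_2d_pt_minus; [|auto].
    apply continuity_2d_pt_minus; [apply continuity_2d_pt_id2|].
    apply continuity_2d_pt_mult; auto. apply continuity_2d_pt_id2.
  - intros y _. split.
    + destruct (HK (s (-B) y * (-B)) (s (-B) y * y)) as [H _].
      pose proof (Rle_trans _ _ _ (Hfst _ _) (Hpr (-B) y)) as H'.
      apply Rabs_le_between in H, H'. unfold B in *; lra.
    + destruct (HK (s B y * B) (s B y * y)) as [H _].
      pose proof (Rle_trans _ _ _ (Hfst _ _) (Hpr B y)) as H'.
      apply Rabs_le_between in H, H'. unfold B in *; lra.
  - intros x _. split.
    + destruct (HK (s x (-B) * x) (s x (-B) * (-B))) as [_ H].
      pose proof (Rle_trans _ _ _ (Hsnd _ _) (Hpr x (-B))) as H'.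
      apply Rabs_le_between in H, H'. unfold B in *; lra.
    + destruct (HK (s x B * x) (s x B * B)) as [_ H].
      pose proof (Rle_trans _ _ _ (Hsnd _ _) (Hpr x B)) as H'.
      apply Rabs_le_between in H, H'. unfold B in *; lra.
  - exists (s x y * x), (s x y * y). split; [apply Hpr|].
    destruct (Rle_lt_dec (sqrt (x ^ 2 + y ^ 2)) r) as [Hle|Hlt].
    + assert (E : s x y = 1) by (unfold s; rewrite Rmax_left by auto; apply Rinv_r; lra).
      rewrite E in *. lra.
    + exfalso.
      assert (Hxy : sqrt ((s x y * x) ^ 2 + (s x y * y) ^ 2) = r).
      { rewrite Hnorm by (apply Rlt_le, Hs). unfold s. rewrite Rmax_right by lra. field. lra. }
      apply Hin in Hxy. destruct (Hs x y) as [H1 H2].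
      replace (P (s x y * x) (s x y * y)) with (x - s x y * x) in Hxy by lra.
      replace (Q (s x y * x) (s x y * y)) with (y - s x y * y) in Hxy by lra.
      assert (0 <= s x y * (1 - s x y)) by nra.
      nra.
Qed.

(** * Integrals of continuous and periodic functions *)

(* [RInt] into [R] is stated over the carrier of a normed module, which [ring] does not see through. *)
Ltac to_R := match goal with |- @eq _ ?x ?y => change (@eq R x y) end.
Ltac Rring := to_R; ring.

Lemma continuous_Rplus (f g : R -> R) (t : R) :
  continuous f t -> continuous g t -> continuous (fun s => f s + g s) t.
Proof. intros; now apply (continuous_plus f g). Qed.

Lemma continuous_Rminus (f g : R -> R) (t : R) :
  continuous f t -> continuous g t -> continuous (fun s => f s - g s) t.
Proof. intros; now apply (continuous_minus f g). Qed.

Lemma continuous_Rmult (f g : R -> R) (t : R) :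
  continuous f t -> continuous g t -> continuous (fun s => f s * g s) t.
Proof. intros; now apply (continuous_mult f g). Qed.

Lemma continuous_Ropp (f : R -> R) (t : R) :
  continuous f t -> continuous (fun s => - f s) t.
Proof. intros; now apply (continuous_opp f). Qed.

Ltac solve_continuous :=
  match goal with
  | |- continuous (fun _ => ?c) _ => apply continuous_const
  | |- continuous (fun s => s) _ => apply continuous_id
  | H : forall t, continuous ?f t |- continuous ?f _ => apply H
  | H : forall t, continuous ?f t |- continuous (fun s => ?f s) _ => apply H
  | |- continuous cos _ => apply continuous_cos
  | |- continuous (fun s => @?f s + @?g s) _ => apply (continuous_Rplus f g); solve_continuous
  | |- continuous (fun s => @?f s - @?g s) _ => apply (continuous_Rminus f g); solve_continuous
  | |- continuous (fun s => @?f s * @?g s) _ => apply (continuous_Rmult f g); solve_continuous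
  | |- continuous (fun s => - @?f s) _ => apply (continuous_Ropp f); solve_continuous
  | |- continuous (fun s => cos (@?f s)) _ => apply (continuous_cos_comp f); solve_continuous
  | |- continuous (fun s => sin (@?f s)) _ => apply (continuous_sin_comp f); solve_continuous
  | |- continuous (fun s => Rabs (@?f s)) _ => apply (continuous_Rabs_comp f); solve_continuous
  | H : forall t, continuous ?f t |- continuous (fun s => ?f (@?g s)) _ =>
      apply (continuous_comp g f); [solve_continuous | apply H]
  end.

Lemma ex_RInt_cont (f : R -> R) (a b : R) :
  (forall t, continuous f t) -> ex_RInt f a b.
Proof. intros H; apply (ex_RInt_continuous f); intros; apply H. Qed.

Lemma RInt_Rplus (f g : R -> R) (a b : R) :
  (forall t, continuous f t) -> (forall t, continuous g t) ->
  RInt (fun t => f t + g t) a b = RInt f a b + RInt g a b.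
Proof. intros; apply (RInt_plus f g); now apply ex_RInt_cont. Qed.

Lemma RInt_Rminus (f g : R -> R) (a b : R) :
  (forall t, continuous f t) -> (forall t, continuous g t) ->
  RInt (fun t => f t - g t) a b = RInt f a b - RInt g a b.
Proof. intros; apply (RInt_minus f g); now apply ex_RInt_cont. Qed.

Lemma RInt_Rscal (c : R) (f : R -> R) (a b : R) :
  (forall t, continuous f t) -> RInt (fun t => c * f t) a b = c * RInt f a b.
Proof. intros; apply (RInt_scal f a b c); now apply ex_RInt_cont. Qed.

Lemma RInt_Rchasles (f : R -> R) (a b c : R) :
  (forall t, continuous f t) -> RInt f a b + RInt f b c = RInt f a c.
Proof. intros; apply (RInt_Chasles f); now apply ex_RInt_cont. Qed.

Lemma RInt_monotone (f g : R -> R) (a b : R) :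
  a <= b -> (forall t, continuous f t) -> (forall t, continuous g t) ->
  (forall t, a <= t <= b -> f t <= g t) -> RInt f a b <= RInt g a b.
Proof.
  intros Hab Hf Hg H. apply RInt_le; auto using ex_RInt_cont.
  intros; apply H; lra.
Qed.

Lemma RInt_antiderivative (F f : R -> R) (a b : R) :
  (forall t, is_derive F t (f t)) -> (forall t, continuous f t) ->
  RInt f a b = F b - F a.
Proof. intros HF Hf. apply is_RInt_unique. now apply (is_RInt_derive F f). Qed.

Lemma RInt_shift (g : R -> R) (T a b : R) :
  (forall t, continuous g t) ->
  RInt (fun t => g (t + T)) a b = RInt g (a + T) (b + T).
Proof.
  intros Hg. generalize (RInt_comp_lin g 1 T a b). rewrite !Rmult_1_l.
  intros H; rewrite <- H by now apply ex_RInt_cont.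
  apply RInt_ext; intros. unfold scal; simpl; unfold mult; simpl.
  now rewrite !Rmult_1_l.
Qed.

Lemma RInt_period (g : R -> R) (T a b : R) :
  (forall t, continuous g t) -> (forall t, g (t + T) = g t) ->
  RInt g a (a + T) = RInt g b (b + T).
Proof.
  intros Hg HT.
  rewrite <- (RInt_Rchasles g a b (a + T)), <- (RInt_Rchasles g b (b + T) (a + T)) by auto.
  rewrite <- (RInt_shift g T b a) by auto.
  rewrite (RInt_ext (fun t => g (t + T)) g) by auto.
  rewrite (Rplus_comm (RInt g b (b + T))), <- Rplus_assoc.
  rewrite (RInt_Rchasles g a b a) by auto.
  rewrite (RInt_point a g). unfold zero; simpl. ring.
Qed.

Lemma RInt_periods (g : R -> R) (T a b : R) (k : nat) :
  (forall t, continuous g t) -> (forall t, g (t + T) = g t) ->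
  RInt g a (a + INR k * T) = INR k * RInt g b (b + T).
Proof.
  intros Hg HT. induction k as [|k IH].
  - simpl. rewrite !Rmult_0_l, Rplus_0_r. apply (RInt_point a g).
  - rewrite <- (RInt_Rchasles g a (a + INR k * T)) by auto.
    rewrite IH, S_INR.
    replace (a + (INR k + 1) * T) with (a + INR k * T + T) by ring.
    rewrite (RInt_period g T (a + INR k * T) b) by auto. Rring.
Qed.

Lemma RInt_abs_cos : RInt (fun t => Rabs (cos t)) (- (PI / 2)) (- (PI / 2) + PI) = 2.
Proof.
  pose proof PI_RGT_0.
  replace (- (PI / 2) + PI) with (PI / 2) by field.
  rewrite (RInt_ext _ cos).
  - rewrite (RInt_antiderivative sin cos).
    + rewrite sin_neg, sin_PI2. Rring.
    + intros; apply is_derive_sin.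
    + apply continuous_cos.
  - intros t. rewrite Rmin_left, Rmax_right by lra. intros Ht.
    apply Rabs_right, Rle_ge, cos_ge_0; lra.
Qed.

(** The substitution u = n t - theta turns the interval into 2n periods of |cos|, of length pi and
    integral 2 each; the factor 1/n then leaves 4 whatever n and theta are. *)
Lemma RInt_abs_cos_lin (n : nat) (theta : R) : (1 <= n)%nat ->
  RInt (fun t => Rabs (cos (INR n * t - theta))) 0 (2 * PI) = 4.
Proof.
  intros hn. assert (Hn : 0 < INR n) by (apply lt_0_INR; lia).
  generalize (RInt_comp_lin (fun u => Rabs (cos u)) (INR n) (- theta) 0 (2 * PI)).
  intros H.
  assert (Hc : forall t, continuous (fun u => Rabs (cos u)) t)
    by (intros; solve_continuous; apply continuous_cos).
  rewrite (RInt_ext _ (fun t => / INR n * (INR n * Rabs (cos (INR n * t + - theta)))))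
    by (intros; to_R; unfold Rminus; field; lra).
  rewrite RInt_Rscal by (intros; solve_continuous).
  unfold scal in H; simpl in H; unfold mult in H; simpl in H.
  rewrite H by now apply ex_RInt_cont.
  replace (INR n * (2 * PI) + - theta) with (INR n * 0 + - theta + INR (2 * n) * PI)
    by (rewrite mult_INR; simpl; ring).
  rewrite (RInt_periods _ PI _ (- (PI / 2))), RInt_abs_cos, mult_INR; auto.
  - to_R; simpl; field; lra.
  - intros t. rewrite neg_cos. apply Rabs_Ropp.
Qed.

(** * Waves a cos nt + b sin nt and integrals against them *)

Lemma polar_angle (a b : R) :
  exists theta, a = sqrt (a ^ 2 + b ^ 2) * cos theta /\ b = sqrt (a ^ 2 + b ^ 2) * sin theta.
Proof.
  set (r := sqrt (a ^ 2 + b ^ 2)).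
  assert (Hr2 : r * r = a ^ 2 + b ^ 2) by (apply sqrt_sqrt; nra).
  assert (Hr0 : 0 <= r) by apply sqrt_pos.
  destruct (Req_dec r 0) as [E|E].
  - exists 0. rewrite E in *. split; nra.
  - assert (Hr : 0 < r) by lra.
    assert (Hc : -1 <= a / r <= 1).
    { split; apply (Rmult_le_reg_r r); auto; unfold Rdiv;
        rewrite Rmult_assoc, Rinv_l by lra; nra. }
    assert (Hs : r * sin (acos (a / r)) = Rabs b).
    { rewrite sin_acos by auto. rewrite <- (sqrt_Rsqr r) at 1 by lra.
      rewrite <- sqrt_mult_alt by (unfold Rsqr; nra). rewrite <- sqrt_Rsqr_abs. f_equal.
      unfold Rsqr. field_simplify; [|lra].
      replace (r ^ 2) with (r * r) by ring. rewrite Hr2. ring. }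
    destruct (Rle_dec 0 b) as [Hb|Hb].
    + exists (acos (a / r)). rewrite cos_acos by auto. rewrite Hs, Rabs_right by lra.
      split; [field; lra | reflexivity].
    + exists (- acos (a / r)). rewrite cos_neg, sin_neg, cos_acos by auto.
      rewrite Ropp_mult_distr_r_reverse, Hs, Rabs_left by lra.
      split; [field; lra | ring].
Qed.

(** The general solution of x'' + n^2 x = 0. *)
Definition wave (n : nat) (a b t : R) : R := a * cos (INR n * t) + b * sin (INR n * t).

Lemma continuous_wave (n : nat) (a b t : R) : continuous (wave n a b) t.
Proof. unfold wave. solve_continuous. Qed.

Lemma RInt_abs_wave (n : nat) (a b : R) : (1 <= n)%nat ->
  RInt (fun t => Rabs (wave n a b t)) 0 (2 * PI) = 4 * sqrt (a ^ 2 + b ^ 2).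
Proof.
  intros hn. destruct (polar_angle a b) as (theta & Ha & Hb).
  set (r := sqrt (a ^ 2 + b ^ 2)) in *.
  rewrite (RInt_ext _ (fun t => r * Rabs (cos (INR n * t - theta)))).
  - rewrite RInt_Rscal, RInt_abs_cos_lin by (auto; intros; solve_continuous). Rring.
  - intros t _. rewrite <- (Rabs_right r) by apply Rle_ge, sqrt_pos.
    rewrite <- Rabs_mult, cos_minus. f_equal. unfold wave. rewrite Ha, Hb at 1. Rring.
Qed.

Lemma cos_sin_period_INR (n : nat) (t : R) :
  cos (INR n * (t + 2 * PI)) = cos (INR n * t) /\ sin (INR n * (t + 2 * PI)) = sin (INR n * t).
Proof.
  replace (INR n * (t + 2 * PI)) with (INR n * t + 2 * INR n * PI) by ring.
  now rewrite cos_period, sin_period.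
Qed.

Lemma RInt_wave (n : nat) (a b : R) : (1 <= n)%nat ->
  RInt (wave n a b) 0 (2 * PI) = 0.
Proof.
  intros hn. assert (Hn : 0 < INR n) by (apply lt_0_INR; lia).
  set (g := fun t => a * sin (INR n * t) / INR n - b * cos (INR n * t) / INR n).
  rewrite (RInt_antiderivative g).
  - destruct (cos_sin_period_INR n 0) as [H1 H2]. rewrite Rplus_0_l in H1, H2.
    unfold g. rewrite H1, H2. Rring.
  - intros t. unfold g, wave. auto_derive; auto. field. lra.
  - apply continuous_wave.
Qed.

(** The comparison integrand of both directions: a mid value [m] of F is killed by orthogonality to
    constants, so only the deviation [d] from it counts. [C] absorbs the times at which the wave is
    small. *)
Lemma RInt_wave_affine (n : nat) (a b m d C : R) : (1 <= n)%nat ->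
  RInt (fun t => m * wave n a b t + (d * Rabs (wave n a b t) + C)) 0 (2 * PI) =
  4 * d * sqrt (a ^ 2 + b ^ 2) + 2 * PI * C.
Proof.
  intros hn. pose proof (continuous_wave n a b) as Hw.
  rewrite RInt_Rplus, RInt_Rplus, !RInt_Rscal by (intros; solve_continuous).
  rewrite RInt_abs_wave, RInt_wave by auto.
  rewrite (RInt_const 0 (2 * PI) C). unfold scal; simpl; unfold mult; simpl. Rring.
Qed.

Lemma RInt_wave_le (n : nat) (a b m d : R) (h : R -> R) : (1 <= n)%nat ->
  (forall t, continuous h t) ->
  (forall t, 0 <= t <= 2 * PI -> Rabs (h t - m) <= d) ->
  RInt (fun t => h t * wave n a b t) 0 (2 * PI) <= 4 * d * sqrt (a ^ 2 + b ^ 2).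
Proof.
  intros hn Hh Hd. pose proof PI_RGT_0. pose proof (continuous_wave n a b) as Hw.
  replace (4 * d * sqrt (a ^ 2 + b ^ 2)) with (4 * d * sqrt (a ^ 2 + b ^ 2) + 2 * PI * 0) by ring.
  rewrite <- (RInt_wave_affine n a b m d 0 hn).
  apply RInt_monotone; [lra | intros; solve_continuous | intros; solve_continuous |].
  intros t Ht. specialize (Hd t Ht).
  assert (Rabs ((h t - m) * wave n a b t) <= d * Rabs (wave n a b t)).
  { rewrite Rabs_mult. apply Rmult_le_compat_r; auto. apply Rabs_pos. }
  pose proof (Rle_abs ((h t - m) * wave n a b t)). lra.
Qed.

(** Where the wave exceeds K + M in absolute value, x lies beyond the threshold M on the side given
    by the sign of the wave, so F(x) is within [eps] of the matching limit and the integrand is at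
    least its mid-value part plus (D/2 - eps) |wave|. The point of the statement is that [C] does
    not depend on a, b or x. *)
Lemma resonance_lower_bound (n : nat) (F : R -> R) (Fp Fm eps K : R) : (1 <= n)%nat ->
  (forall t, continuous F t) -> is_lim F p_infty Fp -> is_lim F m_infty Fm ->
  (forall x, Fm < F x < Fp) -> 0 < eps -> 0 <= K ->
  exists C, 0 <= C /\ forall a b x, (forall t, continuous x t) ->
    (forall t, 0 <= t <= 2 * PI -> Rabs (x t - wave n a b t) <= K) ->
    (2 * (Fp - Fm) - 4 * eps) * sqrt (a ^ 2 + b ^ 2) - C <=
    RInt (fun t => F (x t) * wave n a b t) 0 (2 * PI).
Proof.
  intros hn HF Hp Hm Hb Heps HK. pose proof PI_RGT_0.
  apply is_lim_spec in Hp, Hm.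
  destruct (Hp (mkposreal eps Heps)) as [Mp HMp].
  destruct (Hm (mkposreal eps Heps)) as [Mm HMm]. simpl in HMp, HMm.
  set (M := Rmax 0 (Rmax Mp (- Mm))).
  assert (M0 : 0 <= M) by apply Rmax_l.
  assert (M1 : Mp <= M) by (eapply Rle_trans; [apply Rmax_l | apply Rmax_r]).
  assert (M2 : - Mm <= M) by (eapply Rle_trans; [apply Rmax_r | apply Rmax_r]).
  set (D := Fp - Fm). assert (HD : 0 < D) by (specialize (Hb 0); unfold D; lra).
  (* Where |wave| <= K + M the side of x is unknown: F(x) minus the mid value, times the wave, may
     drop to - D/2 |wave|, which misses D/2 |wave| by at most D (K + M). *)
  exists (2 * PI * (D * (K + M))). split.
  { apply Rmult_le_pos; [lra|]. apply Rmult_le_pos; lra. }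
  intros a b x Hx Hxg. pose proof (continuous_wave n a b) as Hw.
  replace (_ - _) with (4 * (D / 2 - eps) * sqrt (a ^ 2 + b ^ 2) + 2 * PI * (- (D * (K + M))))
    by (unfold D; field).
  rewrite <- (RInt_wave_affine n a b ((Fp + Fm) / 2)) by auto.
  apply RInt_monotone; [lra | intros; solve_continuous | intros; solve_continuous |].
  intros t Ht. specialize (Hxg t Ht). specialize (Hb (x t)).
  specialize (HMp (x t)). specialize (HMm (x t)).
  set (g := wave n a b t) in *. apply Rabs_le_between in Hxg.
  assert (0 <= D * (K + M)) by (apply Rmult_le_pos; lra).
  assert (Ep : D = Fp - Fm) by reflexivity.
  destruct (Rlt_le_dec (K + M) g) as [Hg|Hg]; [|destruct (Rlt_le_dec g (- (K + M))) as [Hg'|Hg']].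
  - rewrite Rabs_right by lra.
    assert (HF1 : Rabs (F (x t) - Fp) < eps) by (apply HMp; lra).
    apply Rabs_def2 in HF1.
    assert ((Fp - eps) * g <= F (x t) * g) by (apply Rmult_le_compat_r; lra).
    rewrite Ep in *. lra.
  - rewrite Rabs_left by lra.
    assert (HF1 : Rabs (F (x t) - Fm) < eps) by (apply HMm; lra).
    apply Rabs_def2 in HF1.
    assert ((Fm + eps) * g <= F (x t) * g) by nra.
    rewrite Ep in *. lra.
  - assert (Hga : Rabs g <= K + M) by (apply Rabs_le; lra).
    assert (Rabs ((F (x t) - (Fp + Fm) / 2) * g) <= D / 2 * Rabs g).
    { rewrite Rabs_mult. apply Rmult_le_compat_r; [apply Rabs_pos|]. apply Rabs_le; lra. }
    pose proof (Rle_abs (- ((F (x t) - (Fp + Fm) / 2) * g))) as H2. rewrite Rabs_Ropp in H2.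
    assert (D * Rabs g <= D * (K + M)) by (apply Rmult_le_compat_l; lra).
    assert (0 <= eps * Rabs g) by (apply Rmult_le_pos; [lra | apply Rabs_pos]).
    lra.
Qed.

(** * Reduction to one period; the primitive F *)

Lemma periodic_2PI_IZR (x : R -> R) (k : Z) (t : R) :
  periodic_2PI x -> x (t + IZR k * (2 * PI)) = x t.
Proof.
  intros Hx.
  assert (Hn : forall (m : nat) s, x (s + INR m * (2 * PI)) = x s).
  { induction m as [|m IH]; intros s.
    - simpl. f_equal. ring.
    - rewrite S_INR, <- (IH s), <- (Hx (s + INR m * (2 * PI))). f_equal. ring. }
  destruct (Z.le_gt_cases 0 k) as [Hk|Hk].
  - rewrite <- (Z2Nat.id k) by lia. rewrite <- INR_IZR_INZ. apply Hn.
  - rewrite <- (Hn (Z.to_nat (- k)) (t + _)). rewrite INR_IZR_INZ, Z2Nat.id by lia.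
    rewrite opp_IZR. f_equal. ring.
Qed.

Lemma periodic_2PI_reduce (t : R) :
  exists s, 0 <= s <= 2 * PI /\ forall x, periodic_2PI x -> x s = x t.
Proof.
  pose proof PI_RGT_0.
  destruct (base_Int_part (t / (2 * PI))) as [H1 H2].
  exists (t + IZR (- Int_part (t / (2 * PI))) * (2 * PI)). split.
  - rewrite opp_IZR.
    assert (E : t = t / (2 * PI) * (2 * PI)) by (field; lra).
    set (q := t / (2 * PI)) in *. set (i := IZR (Int_part q)) in *. rewrite E. nra.
  - intros x Hx. now apply periodic_2PI_IZR.
Qed.

Lemma continuous_le_max (g : R -> R) (a b : R) : a <= b ->
  (forall t, continuous g t) ->
  exists s, forall t, a <= t <= b -> g t <= g s.
Proof.
  intros Hab Hg. destruct (continuity_ab_maj g a b Hab) as [s [Hs _]].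
  - intros c _. apply continuity_pt_filterlim, Hg.
  - now exists s.
Qed.

Lemma periodic_2PI_bounded (e : R -> R) : (forall t, continuous e t) -> periodic_2PI e ->
  exists K, forall t, Rabs (e t) <= K.
Proof.
  intros He Hp. pose proof PI_RGT_0.
  destruct (continuous_le_max (fun t => Rabs (e t)) 0 (2 * PI)) as [s Hs];
    [lra | intros; solve_continuous |].
  exists (Rabs (e s)). intros t. destruct (periodic_2PI_reduce t) as (u & Hu & E).
  rewrite <- E by auto. now apply Hs.
Qed.

Lemma is_derive_RInt_cont (f : R -> R) (a x : R) : (forall t, continuous f t) ->
  is_derive (fun u => RInt f a u) x (f x).
Proof.
  intros Hf. apply (is_derive_RInt f (fun u => RInt f a u) a); auto.
  apply filter_forall; intros y.
  apply (RInt_correct (V := R_CompleteNormedModule) f a y). now apply ex_RInt_cont.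
Qed.

Lemma is_derive_int_from_0 (f : R -> R) (x : R) : (forall t, continuous f t) ->
  is_derive (int_from_0 f) x (f x).
Proof. apply is_derive_RInt_cont. Qed.

Lemma continuous_int_from_0 (f : R -> R) (x : R) : (forall t, continuous f t) ->
  continuous (int_from_0 f) x.
Proof.
  intros Hf. apply (ex_derive_continuous (int_from_0 f)). eexists. now apply is_derive_int_from_0.
Qed.

(** * Necessity *)

(* The coefficients are read off the derivatives of x' cos nt + n x sin nt + F(x) cos nt and
   x' sin nt - n x cos nt + F(x) sin nt. *)
Lemma fourier_coeffs (n : nat) (f e x : R -> R) :
  (forall t, continuous f t) -> (forall t, continuous e t) -> periodic_solution n f e x ->
  cos_coeff e n = INR n * RInt (fun t => int_from_0 f (x t) * sin (INR n * t)) 0 (2 * PI) /\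
  sin_coeff e n = - INR n * RInt (fun t => int_from_0 f (x t) * cos (INR n * t)) 0 (2 * PI).
Proof.
  intros Hf He [[H1 [H2 H3]] [Heq Hper]].
  assert (Hx : forall t, is_derive x t (Derive x t)) by (intros; now apply Derive_correct).
  assert (Hx' : forall t, is_derive (Derive x) t (Derive (Derive x) t)) by (intros; now apply Derive_correct).
  assert (Cx : forall t, continuous x t) by (intros; now apply (ex_derive_continuous x), H1).
  assert (Cx' : forall t, continuous (Derive x) t) by (intros; now apply (ex_derive_continuous (Derive x)), H2).
  pose proof (fun y => continuous_int_from_0 f y Hf) as CF.
  assert (HFx : forall t, is_derive (fun t => int_from_0 f (x t)) t (Derive x t * f (x t))).
  { intros t. apply (is_derive_comp (int_from_0 f) x); auto. now apply is_derive_int_from_0. }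
  assert (Hper' : Derive x (0 + 2 * PI) = Derive x 0).
  { rewrite <- (Derive_ext (fun t => x (t + 2 * PI)) x 0 Hper).
    apply eq_sym, is_derive_unique.
    rewrite <- (Rmult_1_l (Derive x (0 + 2 * PI))).
    apply (is_derive_comp x (fun t => t + 2 * PI)); auto.
    auto_derive; auto. }
  destruct (cos_sin_period_INR n 0) as [Ec Es].
  pose proof (Hper 0) as Ex. rewrite !Rplus_0_l in *.
  assert (Cc : forall t, continuous (fun t => int_from_0 f (x t) * sin (INR n * t)) t)
    by (intros; solve_continuous).
  assert (Cs : forall t, continuous (fun t => int_from_0 f (x t) * cos (INR n * t)) t)
    by (intros; solve_continuous).
  assert (Key : forall G g, (forall t, is_derive G t (g t)) -> (forall t, continuous g t) ->
    G (2 * PI) = G 0 -> RInt g 0 (2 * PI) = 0).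
  { intros G g HG Hg EG. rewrite (RInt_antiderivative G g) by auto. rewrite EG. Rring. }
  split; apply Rminus_diag_uniq.
  - unfold cos_coeff. rewrite <- RInt_Rscal, <- RInt_Rminus by (intros; solve_continuous).
    apply (Key (fun t => Derive x t * cos (INR n * t) + INR n * (x t * sin (INR n * t))
                        + int_from_0 f (x t) * cos (INR n * t))).
    + intros t. rewrite <- Heq.
      evar_last.
      * apply @is_derive_plus; [apply @is_derive_plus|].
        -- apply @is_derive_mult; [apply Hx' | auto_derive; [auto | reflexivity] | intros; apply Rmult_comm].
        -- apply is_derive_scal. apply @is_derive_mult; [apply Hx | auto_derive; [auto | reflexivity] | intros; apply Rmult_comm].
        -- apply @is_derive_mult; [apply HFx | auto_derive; [auto | reflexivity] | intros; apply Rmult_comm].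
      * unfold plus, mult; simpl. unfold mult; simpl. ring.
    + intros; solve_continuous.
    + rewrite Ex, Ec, Es, Hper'. reflexivity.
  - unfold sin_coeff. rewrite <- RInt_Rscal, <- RInt_Rminus by (intros; solve_continuous).
    apply (Key (fun t => Derive x t * sin (INR n * t) + - INR n * (x t * cos (INR n * t))
                        + int_from_0 f (x t) * sin (INR n * t))).
    + intros t. rewrite <- Heq.
      evar_last.
      * apply @is_derive_plus; [apply @is_derive_plus|].
        -- apply @is_derive_mult; [apply Hx' | auto_derive; [auto | reflexivity] | intros; apply Rmult_comm].
        -- apply is_derive_scal. apply @is_derive_mult; [apply Hx | auto_derive; [auto | reflexivity] | intros; apply Rmult_comm].
        -- apply @is_derive_mult; [apply HFx | auto_derive; [auto | reflexivity] | intros; apply Rmult_comm].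
      * unfold plus, mult; simpl. unfold mult; simpl. ring.
    + intros; solve_continuous.
    + rewrite Ex, Ec, Es, Hper'. reflexivity.
Qed.

(** The single test wave - B cos nt + A sin nt merges both coefficient identities: A^2 + B^2 is n
    times the integral of F(x(t)) against it, hence at most 4 n d rho with rho = sqrt(A^2 + B^2).
    Here d is the largest distance of F(x(t)) from the mid value over a period; being attained, it
    is strictly below half the gap. *)
Lemma resonance_necessary (n : nat) (f e x : R -> R) (Fp Fm : R) : (1 <= n)%nat ->
  (forall t, continuous f t) -> (forall t, continuous e t) ->
  (forall y, Fm < int_from_0 f y < Fp) -> periodic_solution n f e x ->
  sqrt (cos_coeff e n ^ 2 + sin_coeff e n ^ 2) < 2 * INR n * (Fp - Fm).
Proof.
  intros hn Hf He Hb Hsol. pose proof PI_RGT_0.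
  assert (Hn : 0 < INR n) by (apply lt_0_INR; lia).
  destruct (fourier_coeffs n f e x Hf He Hsol) as [EA EB].
  destruct Hsol as [[H1 _] _].
  set (A := cos_coeff e n) in *. set (B := sin_coeff e n) in *.
  set (h := fun t => int_from_0 f (x t)).
  pose proof (fun y => continuous_int_from_0 f y Hf) as CF.
  assert (Cx : forall t, continuous x t) by (intros; now apply (ex_derive_continuous x), H1).
  assert (Ch : forall t, continuous h t) by (intros; unfold h; solve_continuous).
  set (m := (Fp + Fm) / 2).
  destruct (continuous_le_max (fun t => Rabs (h t - m)) 0 (2 * PI)) as [s Hs];
    [lra | intros; solve_continuous |].
  set (d := Rabs (h s - m)) in *.
  assert (Hd : 2 * d < Fp - Fm).
  { specialize (Hb (x s)). unfold d, h, m. unfold Rabs; destruct (Rcase_abs _); lra. }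
  pose proof (RInt_wave_le n (- B) A m d h hn Ch Hs) as Hle.
  assert (Esq : INR n * RInt (fun t => h t * wave n (- B) A t) 0 (2 * PI) = A ^ 2 + B ^ 2).
  { rewrite (RInt_ext _ (fun t => A * (h t * sin (INR n * t)) - B * (h t * cos (INR n * t))))
      by (intros; unfold wave; Rring).
    rewrite RInt_Rminus, !RInt_Rscal by (intros; solve_continuous).
    replace (A ^ 2 + B ^ 2) with (A * A + B * B) by ring.
    rewrite EA at 2. rewrite EB at 2. unfold h. Rring. }
  replace ((- B) ^ 2 + A ^ 2) with (A ^ 2 + B ^ 2) in Hle by ring.
  set (rho := sqrt (A ^ 2 + B ^ 2)) in *.
  assert (Hr : rho * rho = A ^ 2 + B ^ 2) by (apply sqrt_sqrt; nra).
  assert (0 <= rho) by apply sqrt_pos.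
  destruct (Req_dec rho 0) as [E|E].
  - rewrite E. specialize (Hb 0). apply Rmult_lt_0_compat; lra.
  - apply (Rmult_le_compat_l (INR n)) in Hle; [|lra].
    rewrite Esq, <- Hr in Hle.
    assert (rho <= 4 * INR n * d) by (apply (Rmult_le_reg_r rho); lra).
    nra.
Qed.

(** * Fixed points in an exponentially weighted norm *)

(** Integration gains the factor 1/lam in the norm sup |g(s)| exp(- lam |s|), which lets a Picard
    operator contract on the whole line at once. Negative times are reflected to positive ones. *)
Lemma RInt_exp_weight (g : R -> R) (lam D t : R) : 0 < lam -> 0 <= D ->
  (forall s, continuous g s) ->
  (forall s, Rabs (g s) <= D * exp (lam * Rabs s)) ->
  Rabs (RInt g 0 t) <= D / lam * exp (lam * Rabs t).
Proof.
  intros Hl HD. revert g t.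
  assert (Hpos : forall g t, 0 <= t -> (forall s, continuous g s) ->
    (forall s, Rabs (g s) <= D * exp (lam * Rabs s)) ->
    Rabs (RInt g 0 t) <= D / lam * exp (lam * Rabs t)).
  { intros g t Ht Hg Hb.
    assert (Hc : forall s, continuous (fun s => D * exp (lam * s)) s).
    { intros s. apply (ex_derive_continuous (fun s => D * exp (lam * s))). auto_derive; auto. }
    apply Rle_trans with (RInt (fun s => Rabs (g s)) 0 t).
    { apply abs_RInt_le; auto. now apply ex_RInt_cont. }
    apply Rle_trans with (RInt (fun s => D * exp (lam * s)) 0 t).
    { apply RInt_monotone; auto.
      - intros; solve_continuous.
      - intros s Hs. rewrite <- (Rabs_right s) at 2 by lra. apply Hb. }
    rewrite (RInt_antiderivative (fun s => D / lam * exp (lam * s))); auto.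
    - rewrite Rmult_0_r, exp_0, Rabs_right by lra.
      assert (0 <= D / lam) by (apply Rmult_le_pos; [lra | apply Rlt_le, Rinv_0_lt_compat, Hl]).
      lra.
    - intros s. auto_derive; auto. field. lra. }
  intros g t Hg Hb. destruct (Rle_lt_dec 0 t) as [Ht|Ht]; [now apply Hpos|].
  assert (Hg' : forall s, continuous (fun s => g (- s)) s).
  { intros s. apply (continuous_comp Ropp g); [apply continuous_Ropp, continuous_id | apply Hg]. }
  generalize (RInt_comp_lin g (-1) 0 0 (- t)).
  replace (-1 * 0 + 0) with 0 by ring. replace (-1 * - t + 0) with t by ring.
  intros E. rewrite <- E by now apply ex_RInt_cont.
  rewrite (RInt_ext _ (fun s => (-1) * g (- s))).
  2: { intros s _. unfold scal; simpl; unfold mult; simpl. do 2 f_equal. ring. }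
  rewrite RInt_Rscal by auto. rewrite Rabs_mult, Rabs_m1, Rmult_1_l, <- (Rabs_Ropp t).
  apply Hpos; auto; [lra|]. intros s. rewrite <- (Rabs_Ropp s). apply Hb.
Qed.

Lemma scaled_pow_half_small (C eps : R) : 0 <= C -> 0 < eps ->
  exists N, forall k, (N <= k)%nat -> C * (/ 2) ^ k < eps.
Proof.
  intros HC He. destruct (pow_lt_1_zero (/ 2)) with (y := eps / (C + 1)) as [N HN].
  - rewrite Rabs_right; lra.
  - apply Rdiv_lt_0_compat; lra.
  - exists N. intros k Hk. specialize (HN k Hk).
    assert (0 < (/ 2) ^ k) by (apply pow_lt; lra).
    rewrite Rabs_right in HN by lra.
    apply (Rmult_lt_compat_l (C + 1)) in HN; [|lra].
    replace ((C + 1) * (eps / (C + 1))) with eps in HN by (field; lra).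
    lra.
Qed.

Lemma le_of_le_pow_half (a b C : R) :
  (forall k, a <= b + C * (/ 2) ^ k) -> a <= b.
Proof.
  intros H. apply Rnot_lt_le; intros Hlt.
  destruct (scaled_pow_half_small (Rabs C) (a - b)) as [N HN]; [apply Rabs_pos | lra |].
  specialize (HN N (le_n N)). specialize (H N).
  assert (0 < (/ 2) ^ N) by (apply pow_lt; lra).
  pose proof (Rle_abs C). nra.
Qed.

(** Contraction with ratio 1/2 for sup |x(t)| / w(t), phrased through bounds [D] so that no space of
    functions of finite norm has to be formed. *)
Definition weight_contraction (w : R -> R) (T : (R -> R) -> R -> R) : Prop :=
  forall x y D, (forall t, continuous x t) -> (forall t, continuous y t) -> 0 <= D ->
    (forall t, Rabs (x t - y t) <= D * w t) ->
    forall t, Rabs (T x t - T y t) <= D / 2 * w t.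

Lemma weighted_fixed_point (w : R -> R) (T : (R -> R) -> R -> R) (x0 : R -> R) (D0 : R) :
  (forall t, continuous w t) -> (forall t, 0 < w t) ->
  weight_contraction w T ->
  (forall x, (forall t, continuous x t) -> forall t, continuous (T x) t) ->
  (forall t, continuous x0 t) -> 0 <= D0 ->
  (forall t, Rabs (T x0 t - x0 t) <= D0 * w t) ->
  exists x, (forall t, continuous x t) /\ forall t, T x t = x t.
Proof.
  intros Hw Hw0 HT HTc Hx0 HD0 Hd0.
  set (X := fun k => Nat.iter k T x0).
  assert (HX : forall k t, continuous (X k) t)
    by (induction k as [|k IH]; [exact Hx0 | apply HTc, IH]).
  assert (Hhalf : forall k, 0 < (/ 2) ^ k) by (intros; apply pow_lt; lra).
  assert (Hstep : forall k t, Rabs (X (S k) t - X k t) <= D0 * (/ 2) ^ k * w t).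
  { induction k as [|k IH]; intros t.
    - simpl. rewrite Rmult_1_r. apply Hd0.
    - replace (D0 * (/ 2) ^ S k) with (D0 * (/ 2) ^ k / 2) by (simpl; field).
      apply (HT (X (S k)) (X k)); auto. apply Rmult_le_pos; auto. apply Rlt_le, Hhalf. }
  (* The factor 1 - (1/2)^m is the exact geometric sum; it makes the induction on [m] close. *)
  assert (Htail : forall m k t, Rabs (X (m + k)%nat t - X k t) <= 2 * D0 * (/ 2) ^ k * (1 - (/ 2) ^ m) * w t).
  { induction m as [|m IH]; intros k t.
    - simpl. rewrite !Rminus_diag, Rabs_R0. lra.
    - replace (X (S m + k)%nat t - X k t)
        with ((X (S (m + k)) t - X (m + k)%nat t) + (X (m + k)%nat t - X k t)) by (simpl; ring).
      eapply Rle_trans; [apply Rabs_triang|].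
      specialize (IH k t). specialize (Hstep (m + k)%nat t). rewrite pow_add in Hstep.
      change ((/ 2) ^ S m) with (/ 2 * (/ 2) ^ m). lra. }
  assert (Htail' : forall m k t, Rabs (X (m + k)%nat t - X k t) <= 2 * D0 * (/ 2) ^ k * w t).
  { intros m k t. eapply Rle_trans; [apply Htail|].
    specialize (Hhalf m). specialize (Hw0 t).
    assert (0 <= 2 * D0 * (/ 2) ^ k) by (apply Rmult_le_pos; [lra | apply Rlt_le, pow_lt; lra]).
    apply Rmult_le_compat_r; [lra|]. nra. }
  set (x := fun t => real (Lim_seq (fun k => X k t))).
  assert (Hlim : forall t, is_lim_seq (fun k => X k t) (x t)).
  { intros t. apply Lim_seq_correct', ex_lim_seq_cauchy_corr. intros eps.
    specialize (Hw0 t).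
    destruct (scaled_pow_half_small (2 * D0 * w t) eps) as [N HN];
      [apply Rmult_le_pos; lra | apply cond_pos |].
    assert (Hle : forall p q, (N <= p)%nat -> (p <= q)%nat -> Rabs (X q t - X p t) < eps).
    { intros p q Hp Hq. replace q with ((q - p) + p)%nat by lia.
      eapply Rle_lt_trans; [apply Htail'|]. specialize (HN p Hp). lra. }
    exists N. intros p q Hp Hq. destruct (Nat.le_ge_cases p q).
    - rewrite Rabs_minus_sym. auto.
    - auto. }
  assert (Hclose : forall k t, Rabs (x t - X k t) <= 2 * D0 * (/ 2) ^ k * w t).
  { intros k t.
    apply (is_lim_seq_le (fun m => Rabs (X (m + k)%nat t - X k t)) (fun _ => 2 * D0 * (/ 2) ^ k * w t)
      (Rabs (x t - X k t)) (2 * D0 * (/ 2) ^ k * w t)).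
    - intros; apply Htail'.
    - apply (is_lim_seq_abs _ (x t - X k t)).
      apply is_lim_seq_minus'; [apply (is_lim_seq_incr_n (fun m => X m t) k); auto | apply is_lim_seq_const].
    - apply is_lim_seq_const. }
  assert (Hxc : forall t, continuous x t).
  { intros t0. apply filterlim_locally. intros eps. pose proof (cond_pos eps) as He.
    destruct (scaled_pow_half_small (2 * D0 * (w t0 + 1)) (eps / 3)) as [N HN];
      [specialize (Hw0 t0); apply Rmult_le_pos; lra | lra |].
    specialize (HN N (le_n N)).
    assert (He3 : 0 < eps / 3) by lra.
    pose proof (proj1 (filterlim_locally (X N) (X N t0)) (HX N t0) (mkposreal _ He3)) as L1.
    pose proof (proj1 (filterlim_locally w (w t0)) (Hw t0) (mkposreal 1 Rlt_0_1)) as L2.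
    generalize (filter_and _ _ L1 L2). apply filter_imp. intros t [H1 H2].
    change (Rabs (X N t - X N t0) < eps / 3) in H1. change (Rabs (w t - w t0) < 1) in H2.
    change (Rabs (x t - x t0) < eps).
    apply Rabs_def2 in H2.
    pose proof (Hclose N t) as C1. pose proof (Hclose N t0) as C2.
    rewrite Rabs_minus_sym in C2.
    replace (x t - x t0) with ((x t - X N t) + ((X N t - X N t0) + (X N t0 - x t0))) by ring.
    eapply Rle_lt_trans; [apply Rabs_triang|].
    pose proof (Rabs_triang (X N t - X N t0) (X N t0 - x t0)).
    assert (0 <= 2 * D0 * (/ 2) ^ N) by (apply Rmult_le_pos; [lra | apply Rlt_le, Hhalf]).
    assert (2 * D0 * (/ 2) ^ N * w t <= 2 * D0 * (/ 2) ^ N * (w t0 + 1)) by (apply Rmult_le_compat_l; lra).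
    assert (2 * D0 * (/ 2) ^ N * w t0 <= 2 * D0 * (/ 2) ^ N * (w t0 + 1)) by (apply Rmult_le_compat_l; lra).
    lra. }
  exists x. split; auto. intros t. apply Rminus_diag_uniq, Rabs_eq_0, Rle_antisym; [|apply Rabs_pos].
  apply (le_of_le_pow_half _ _ (2 * D0 * w t)). intros k.
  replace (T x t - x t) with ((T x t - T (X k) t) + (X (S k) t - x t)) by (simpl; ring).
  eapply Rle_trans; [apply Rabs_triang|].
  pose proof (Hclose (S k) t) as C1. rewrite Rabs_minus_sym in C1.
  change ((/ 2) ^ S k) with (/ 2 * (/ 2) ^ k) in C1.
  assert (C2 : Rabs (T x t - T (X k) t) <= 2 * D0 * (/ 2) ^ k / 2 * w t).
  { apply HT; auto. apply Rmult_le_pos; [lra | apply Rlt_le, Hhalf]. }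
  lra.
Qed.

(** The splitting x - y = (T x - T y) + (T y - T' y) improves a bound 2 delta + c to 2 delta + c/2,
    so the crude a priori bound [D] vanishes in the limit. *)
Lemma weighted_fixed_point_stable (w : R -> R) (T T' : (R -> R) -> R -> R) (x y : R -> R) (D delta : R) :
  weight_contraction w T ->
  (forall t, continuous x t) -> (forall t, continuous y t) ->
  (forall t, T x t = x t) -> (forall t, T' y t = y t) ->
  0 <= D -> (forall t, Rabs (x t - y t) <= D * w t) ->
  0 <= delta -> (forall t, Rabs (T y t - T' y t) <= delta * w t) ->
  forall t, Rabs (x t - y t) <= 2 * delta * w t.
Proof.
  intros HT Hx Hy Ex Ey HD H0 Hdelta Hd t.
  assert (Hk : forall k t, Rabs (x t - y t) <= (2 * delta + D * (/ 2) ^ k) * w t).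
  { induction k as [|k IH]; intros s.
    - simpl. specialize (H0 s). specialize (Hd s). pose proof (Rabs_pos (T y s - T' y s)). lra.
    - rewrite <- Ex, <- Ey.
      replace (T x s - T' y s) with ((T x s - T y s) + (T y s - T' y s)) by ring.
      eapply Rle_trans; [apply Rabs_triang|].
      assert (Hp : 0 <= 2 * delta + D * (/ 2) ^ k).
      { apply Rplus_le_le_0_compat; [lra|]. apply Rmult_le_pos; [lra|]. apply pow_le; lra. }
      pose proof (HT x y _ Hx Hy Hp IH s). specialize (Hd s). simpl. lra. }
  apply (le_of_le_pow_half _ _ (D * w t)). intros k. specialize (Hk k t). lra.
Qed.

(** * Variation of constants: existence, uniqueness and dependence on (a, b) *)

Definition drift_cos (n : nat) (G e x : R -> R) (t : R) : R :=
  - (G (x t) * cos (INR n * t)) - / INR n * (e t * sin (INR n * t)).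

Definition drift_sin (n : nat) (G e x : R -> R) (t : R) : R :=
  - (G (x t) * sin (INR n * t)) + / INR n * (e t * cos (INR n * t)).

(* Variation of constants for x'' + (G(x))' + n^2 x = e around the kernel of x'' + n^2 x. *)
Definition picard (n : nat) (G e : R -> R) (a b : R) (x : R -> R) (t : R) : R :=
  wave n (a + RInt (drift_cos n G e x) 0 t) (b + RInt (drift_sin n G e x) 0 t) t.

Lemma Rabs_wave_le (n : nat) (a b t : R) : Rabs (wave n a b t) <= Rabs a + Rabs b.
Proof.
  unfold wave. eapply Rle_trans; [apply Rabs_triang|]. rewrite !Rabs_mult.
  assert (Rabs (cos (INR n * t)) <= 1) by (apply Rabs_le, COS_bound).
  assert (Rabs (sin (INR n * t)) <= 1) by (apply Rabs_le, SIN_bound).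
  pose proof (Rabs_pos a). pose proof (Rabs_pos b). nra.
Qed.

Lemma wave_minus (n : nat) (a b c d t : R) :
  wave n a b t - wave n c d t = wave n (a - c) (b - d) t.
Proof. unfold wave; ring. Qed.

Lemma continuous_drift (n : nat) (G e x : R -> R) :
  (forall t, continuous G t) -> (forall t, continuous e t) -> (forall t, continuous x t) ->
  (forall t, continuous (drift_cos n G e x) t) /\ (forall t, continuous (drift_sin n G e x) t).
Proof.
  intros HG He Hx. unfold drift_cos, drift_sin. split; intros t; solve_continuous.
Qed.

Lemma drift_minus (n : nat) (G e x y : R -> R) (t : R) :
  Rabs (drift_cos n G e x t - drift_cos n G e y t) <= Rabs (G (x t) - G (y t)) /\
  Rabs (drift_sin n G e x t - drift_sin n G e y t) <= Rabs (G (x t) - G (y t)).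
Proof.
  unfold drift_cos, drift_sin.
  assert (Hm : forall z c, -1 <= c <= 1 -> Rabs (- (z * c)) <= Rabs z).
  { intros z c Hc. rewrite Rabs_Ropp, Rabs_mult. rewrite <- (Rmult_1_r (Rabs z)) at 2.
    apply Rmult_le_compat_l; [apply Rabs_pos | now apply Rabs_le]. }
  split.
  - replace (_ - _) with (- ((G (x t) - G (y t)) * cos (INR n * t))) by ring.
    apply Hm, COS_bound.
  - replace (_ - _) with (- ((G (x t) - G (y t)) * sin (INR n * t))) by ring.
    apply Hm, SIN_bound.
Qed.

Section Flow.
Context (n : nat) (G e : R -> R) (L K : R).
Context (HL : 0 < L) (HG : forall t, continuous G t) (He : forall t, continuous e t).
Context (HGL : forall u v, Rabs (G u - G v) <= L * Rabs (u - v)).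
Context (HK : forall x t, Rabs (drift_cos n G e x t) <= K /\ Rabs (drift_sin n G e x t) <= K).

(* The factor 4 makes the Picard operator a contraction with ratio 1/2 for sup |x t| / flow_weight t. *)
Definition flow_weight (t : R) : R := exp (4 * L * Rabs t).

Lemma flow_weight_ge_1 t : 1 <= flow_weight t.
Proof.
  unfold flow_weight. rewrite <- exp_0. pose proof (Rabs_pos t).
  assert (0 <= 4 * L * Rabs t) by (apply Rmult_le_pos; lra).
  destruct (Req_dec (4 * L * Rabs t) 0) as [E|E]; [rewrite E; lra|].
  left; apply exp_increasing; lra.
Qed.

Lemma continuous_flow_weight t : continuous flow_weight t.
Proof.
  apply (continuous_comp (fun t => 4 * L * Rabs t) exp).
  - pose proof continuous_Rabs. solve_continuous.
  - apply (ex_derive_continuous exp). auto_derive; auto.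
Qed.

(** The forcing cancels in the difference and the rate 4 L beats the Lipschitz constant L. The two
    coordinates, D/4 each, add up to the ratio 1/2 of the contraction. *)
Lemma RInt_drift_minus_le (x y : R -> R) (D t : R) :
  (forall t, continuous x t) -> (forall t, continuous y t) -> 0 <= D ->
  (forall t, Rabs (x t - y t) <= D * flow_weight t) ->
  Rabs (RInt (drift_cos n G e x) 0 t - RInt (drift_cos n G e y) 0 t) <= D / 4 * flow_weight t /\
  Rabs (RInt (drift_sin n G e x) 0 t - RInt (drift_sin n G e y) 0 t) <= D / 4 * flow_weight t.
Proof.
  intros Hx Hy HD H.
  destruct (continuous_drift n G e x HG He Hx) as [Cx Sx].
  destruct (continuous_drift n G e y HG He Hy) as [Cy Sy].
  assert (Hb : forall s, Rabs (G (x s) - G (y s)) <= L * D * exp (4 * L * Rabs s)).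
  { intros s. eapply Rle_trans; [apply HGL|]. rewrite Rmult_assoc.
    apply Rmult_le_compat_l; [lra | apply H]. }
  replace (D / 4) with (L * D / (4 * L)) by (field; lra).
  rewrite <- !RInt_Rminus by auto. split; (apply RInt_exp_weight;
    [lra | apply Rmult_le_pos; lra | intros; solve_continuous |]);
    intros s; (eapply Rle_trans; [|apply Hb]); apply drift_minus.
Qed.

Lemma RInt_drift_le (x : R -> R) (t : R) : (forall t, continuous x t) ->
  Rabs (RInt (drift_cos n G e x) 0 t) <= K / (4 * L) * flow_weight t /\
  Rabs (RInt (drift_sin n G e x) 0 t) <= K / (4 * L) * flow_weight t.
Proof.
  intros Hx.
  destruct (continuous_drift n G e x HG He Hx) as [Cx Sx].
  assert (HK0 : 0 <= K).
  { destruct (HK x 0). pose proof (Rabs_pos (drift_cos n G e x 0)). lra. }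
  split; (apply RInt_exp_weight; [lra | lra | auto |]); intros s;
    pose proof (flow_weight_ge_1 s) as Hs; unfold flow_weight in Hs;
    (apply Rle_trans with K; [apply HK | nra]).
Qed.

Lemma picard_contraction (a b : R) : weight_contraction flow_weight (picard n G e a b).
Proof.
  intros x y D Hx Hy HD H t. unfold picard. rewrite wave_minus.
  eapply Rle_trans; [apply Rabs_wave_le|].
  destruct (RInt_drift_minus_le x y D t Hx Hy HD H) as [H1 H2].
  match goal with |- Rabs (a + ?I - (a + ?J)) + Rabs (b + ?I' - (b + ?J')) <= _ =>
    replace (a + I - (a + J)) with (I - J) by Rring;
    replace (b + I' - (b + J')) with (I' - J') by Rring end.
  lra.
Qed.

Lemma continuous_picard (a b : R) (x : R -> R) : (forall t, continuous x t) ->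
  forall t, continuous (picard n G e a b x) t.
Proof.
  intros Hx t. destruct (continuous_drift n G e x HG He Hx) as [Cx Sx].
  assert (HI : forall g : R -> R, (forall t, continuous g t) -> forall t, continuous (fun u => RInt g 0 u) t).
  { intros g Hg u. apply (ex_derive_continuous (fun u => RInt g 0 u)). eexists.
    now apply is_derive_RInt_cont. }
  pose proof (HI _ Cx) as I1. pose proof (HI _ Sx) as I2.
  unfold picard, wave. cbv beta in I1, I2.
  set (p := fun u => RInt (drift_cos n G e x) 0 u) in *.
  set (q := fun u => RInt (drift_sin n G e x) 0 u) in *.
  change (continuous (fun t => (a + p t) * cos (INR n * t) + (b + q t) * sin (INR n * t)) t).
  solve_continuous.
Qed.

(** Supplies the finite weighted distances that the fixed point lemmas start from: of the zero
    function to its image, and of any two fixed points to each other. *)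
Lemma picard_le (a b : R) (x : R -> R) (t : R) : (forall t, continuous x t) ->
  Rabs (picard n G e a b x t) <= (Rabs a + Rabs b + K / (2 * L)) * flow_weight t.
Proof.
  intros Hx. unfold picard. eapply Rle_trans; [apply Rabs_wave_le|].
  destruct (RInt_drift_le x t Hx) as [H1 H2].
  set (I := RInt (drift_cos _ _ _ _) _ _) in *. set (J := RInt (drift_sin _ _ _ _) _ _) in *.
  replace (K / (2 * L)) with (K / (4 * L) + K / (4 * L)) by (field; lra).
  pose proof (Rabs_triang a I). pose proof (Rabs_triang b J).
  pose proof (Rabs_pos a). pose proof (Rabs_pos b). pose proof (flow_weight_ge_1 t). nra.
Qed.

Lemma picard_fixed_point (a b : R) :
  exists x, (forall t, continuous x t) /\ forall t, picard n G e a b x t = x t.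
Proof.
  assert (HK0 : 0 <= K).
  { destruct (HK (fun _ => 0) 0). pose proof (Rabs_pos (drift_cos n G e (fun _ => 0) 0)). lra. }
  apply (weighted_fixed_point flow_weight _ (fun _ => 0) (Rabs a + Rabs b + K / (2 * L))).
  - apply continuous_flow_weight.
  - intros t. pose proof (flow_weight_ge_1 t). lra.
  - apply picard_contraction.
  - apply continuous_picard.
  - intros; apply continuous_const.
  - assert (0 <= K / (2 * L)) by (apply Rmult_le_pos; [lra | apply Rlt_le, Rinv_0_lt_compat; lra]).
    pose proof (Rabs_pos a). pose proof (Rabs_pos b). lra.
  - intros t. rewrite Rminus_0_r. apply picard_le. intros; apply continuous_const.
Qed.

(** Used twice: as Lipschitz dependence on the initial value, which makes the displacement
    continuous, and with equal initial values as uniqueness. *)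
Lemma picard_fixed_point_stable (a b a' b' : R) (x y : R -> R) :
  (forall t, continuous x t) -> (forall t, continuous y t) ->
  (forall t, picard n G e a b x t = x t) -> (forall t, picard n G e a' b' y t = y t) ->
  forall t, Rabs (x t - y t) <= 2 * (Rabs (a - a') + Rabs (b - b')) * flow_weight t.
Proof.
  intros Hx Hy Ex Ey.
  assert (HK0 : 0 <= K / (2 * L)).
  { destruct (HK x 0). pose proof (Rabs_pos (drift_cos n G e x 0)).
    apply Rmult_le_pos; [lra | apply Rlt_le, Rinv_0_lt_compat; lra]. }
  pose proof (Rabs_pos a). pose proof (Rabs_pos b). pose proof (Rabs_pos a'). pose proof (Rabs_pos b').
  pose proof (Rabs_pos (a - a')). pose proof (Rabs_pos (b - b')).
  apply (weighted_fixed_point_stable flow_weight (picard n G e a b) (picard n G e a' b') x y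
    ((Rabs a + Rabs b + K / (2 * L)) + (Rabs a' + Rabs b' + K / (2 * L)))); auto; try lra.
  - apply picard_contraction.
  - intros t. rewrite <- Ex, <- Ey.
    pose proof (picard_le a b x t Hx). pose proof (picard_le a' b' y t Hy).
    unfold Rminus at 1. eapply Rle_trans; [apply Rabs_triang|]. rewrite Rabs_Ropp. lra.
  - intros t. unfold picard. rewrite wave_minus. eapply Rle_trans; [apply Rabs_wave_le|].
    set (I := RInt (drift_cos _ _ _ _) _ _). set (J := RInt (drift_sin _ _ _ _) _ _).
    replace (a + I - (a' + I)) with (a - a') by ring.
    replace (b + J - (b' + J)) with (b - b') by ring.
    pose proof (flow_weight_ge_1 t). nra.
Qed.

(** If the coordinates (a, b) return after time 2 pi, the shift of x by 2 pi has the same initial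
    data, since cos nt, sin nt and e are unchanged by the shift. *)
Lemma picard_fixed_point_periodic (a b : R) (x : R -> R) :
  periodic_2PI e -> (forall t, continuous x t) -> (forall t, picard n G e a b x t = x t) ->
  RInt (drift_cos n G e x) 0 (2 * PI) = 0 -> RInt (drift_sin n G e x) 0 (2 * PI) = 0 ->
  periodic_2PI x.
Proof.
  intros Hper Hx Ex Ec Es t.
  set (y := fun t => x (t + 2 * PI)).
  assert (Hy : forall t, continuous y t).
  { intros s. apply (continuous_comp (fun t => t + 2 * PI) x); [|apply Hx]. solve_continuous. }
  destruct (continuous_drift n G e x HG He Hx) as [Cx Sx].
  assert (HI : forall g h : R -> R, (forall t, continuous g t) -> RInt g 0 (2 * PI) = 0 ->
    (forall t, g (t + 2 * PI) = h t) -> forall s, RInt g 0 (s + 2 * PI) = RInt h 0 s).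
  { intros g h Hg E0 Hgh s.
    rewrite <- (RInt_Rchasles g 0 (2 * PI) (s + 2 * PI)) by auto.
    rewrite <- (RInt_ext (fun t => g (t + 2 * PI)) h) by auto.
    rewrite (RInt_shift g (2 * PI) 0 s) by auto.
    rewrite E0, (Rplus_0_l (2 * PI)). Rring. }
  (* The shifted function solves the same initial value problem. *)
  assert (Ey : forall t, picard n G e a b y t = y t).
  { intros s. unfold y at 2. rewrite <- (Ex (s + 2 * PI)). unfold picard.
    rewrite (HI _ (drift_cos n G e y) Cx Ec), (HI _ (drift_sin n G e y) Sx Es).
    - unfold wave. now destruct (cos_sin_period_INR n s) as [-> ->].
    - intros u. unfold drift_sin, y. destruct (cos_sin_period_INR n u) as [-> ->]. now rewrite Hper.
    - intros u. unfold drift_cos, y. destruct (cos_sin_period_INR n u) as [-> ->]. now rewrite Hper. }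
  pose proof (picard_fixed_point_stable a b a b y x Hy Hx Ey Ex t) as H.
  rewrite !Rminus_diag, Rabs_R0, Rplus_0_r, Rmult_0_r, Rmult_0_l in H.
  apply Rminus_diag_uniq, Rabs_eq_0, Rle_antisym; [exact H | apply Rabs_pos].
Qed.
End Flow.

(** The drift is merely continuous, so the integral equation by itself makes x only C^1. The second
    derivative comes from x' = n y - F(x), whose right-hand side is differentiable because y and
    F(x(t)) are. *)
Lemma picard_fixed_point_solution (n : nat) (f e x : R -> R) (a b : R) : (1 <= n)%nat ->
  (forall t, continuous f t) -> (forall t, continuous e t) -> (forall t, continuous x t) ->
  (forall t, picard n (int_from_0 f) e a b x t = x t) ->
  twice_continuously_differentiable x /\
  (forall t, Derive (Derive x) t + f (x t) * Derive x t + INR n ^ 2 * x t = e t).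
Proof.
  intros hn Hf He Hx Ex. assert (Hn : 0 < INR n) by (apply lt_0_INR; lia).
  set (F := int_from_0 f) in *.
  assert (CF : forall t, continuous F t) by (intros; now apply continuous_int_from_0).
  destruct (continuous_drift n F e x CF He Hx) as [Cp Cq].
  set (al := fun t => a + RInt (drift_cos n F e x) 0 t).
  set (be := fun t => b + RInt (drift_sin n F e x) 0 t).
  assert (Hd : forall c (g : R -> R) t, (forall t, continuous g t) ->
    is_derive (fun u => c + RInt g 0 u) t (g t)).
  { intros c g t Hg. rewrite <- (Rplus_0_l (g t)).
    apply (is_derive_plus (fun _ => c) (fun u => RInt g 0 u)); [apply @is_derive_const|].
    now apply is_derive_RInt_cont. }
  assert (Hal : forall t, is_derive al t (drift_cos n F e x t)) by (intros; now apply Hd).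
  assert (Hbe : forall t, is_derive be t (drift_sin n F e x t)) by (intros; now apply Hd).
  assert (Ext : forall t, x t = al t * cos (INR n * t) + be t * sin (INR n * t))
    by (intros; symmetry; apply Ex).
  assert (Hcos : forall t, is_derive (fun t => cos (INR n * t)) t (- INR n * sin (INR n * t)))
    by (intros; auto_derive; auto; ring).
  assert (Hsin : forall t, is_derive (fun t => sin (INR n * t)) t (INR n * cos (INR n * t)))
    by (intros; auto_derive; auto; ring).
  (* The second Liénard coordinate (x' + F(x)) / n: the pair (x, y) is (al, be) rotated by the angle
     nt. *)
  set (y := fun t => be t * cos (INR n * t) - al t * sin (INR n * t)).
  assert (Hcs : forall t, sin (INR n * t) * sin (INR n * t) = 1 - cos (INR n * t) * cos (INR n * t)).
  { intros t. pose proof (sin2_cos2 (INR n * t)) as H. unfold Rsqr in H. lra. }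
  assert (Hx' : forall t, is_derive x t (INR n * y t - F (x t))).
  { intros t. apply (is_derive_ext (fun t => al t * cos (INR n * t) + be t * sin (INR n * t)));
      [intros; now rewrite <- Ext|].
    evar_last.
    - apply @is_derive_plus; (apply @is_derive_mult; [| |intros; apply Rmult_comm]);
        [apply Hal | apply Hcos | apply Hbe | apply Hsin].
    - unfold plus, mult; simpl; unfold mult; simpl. unfold y, drift_cos, drift_sin.
      ring_simplify. replace (sin (INR n * t) ^ 2) with (1 - cos (INR n * t) * cos (INR n * t))
        by (rewrite <- Hcs; ring). field; lra. }
  assert (Hy' : forall t, is_derive y t (/ INR n * e t - INR n * x t)).
  { intros t. evar_last.
    - apply @is_derive_minus; (apply @is_derive_mult; [| |intros; apply Rmult_comm]);
        [apply Hbe | apply Hcos | apply Hal | apply Hsin].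
    - unfold minus, plus, opp, mult; simpl; unfold mult; simpl.
      replace (INR n * x t) with (INR n * (al t * cos (INR n * t) + be t * sin (INR n * t)))
        by now rewrite <- Ext.
      unfold drift_cos, drift_sin.
      ring_simplify. replace (sin (INR n * t) ^ 2) with (1 - cos (INR n * t) * cos (INR n * t))
        by (rewrite <- Hcs; ring). field; lra. }
  assert (Dx : forall t, Derive x t = INR n * y t - F (x t))
    by (intros; now apply is_derive_unique).
  assert (Hx'' : forall t, is_derive (Derive x) t (e t - INR n ^ 2 * x t - f (x t) * Derive x t)).
  { intros t. apply (is_derive_ext (fun t => INR n * y t - F (x t))); [intros; now rewrite Dx|].
    evar_last.
    - apply @is_derive_minus; [apply is_derive_scal, Hy' | apply (is_derive_comp F x); [|apply Hx']].
      now apply is_derive_int_from_0.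
    - unfold minus, plus, opp, scal; simpl; unfold mult; simpl. rewrite Dx. field. lra. }
  assert (DDx : forall t, Derive (Derive x) t = e t - INR n ^ 2 * x t - f (x t) * Derive x t)
    by (intros; now apply is_derive_unique).
  assert (CDx : forall t, continuous (Derive x) t)
    by (intros; apply (ex_derive_continuous (Derive x)); eexists; apply Hx'').
  repeat split.
  - intros t. eexists. apply Hx'.
  - intros t. eexists. apply Hx''.
  - intros t. apply (continuous_ext (fun t => e t - INR n ^ 2 * x t - f (x t) * Derive x t));
      [intros; now rewrite DDx|]. solve_continuous.
  - intros t. rewrite DDx. ring.
Qed.

(** * Lipschitz truncation and a priori bounds *)

Lemma lipschitz_continuous (G : R -> R) (L : R) : 0 < L ->
  (forall u v, Rabs (G u - G v) <= L * Rabs (u - v)) -> forall t, continuous G t.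
Proof.
  intros HL HG t. apply filterlim_locally. intros eps. pose proof (cond_pos eps).
  assert (Hd : 0 < eps / L) by (apply Rdiv_lt_0_compat; lra).
  exists (mkposreal _ Hd). intros u Hu. change (Rabs (u - t) < eps / L) in Hu.
  change (Rabs (G u - G t) < eps). eapply Rle_lt_trans; [apply HG|].
  apply (Rmult_lt_compat_l L) in Hu; auto.
  replace (L * (eps / L)) with (pos eps) in Hu by (field; lra). exact Hu.
Qed.

Lemma lipschitz_continuity_2d_pt (P : R -> R -> R) (L : R) : 0 < L ->
  (forall a b a' b', Rabs (P a b - P a' b') <= L * (Rabs (a - a') + Rabs (b - b'))) ->
  forall a b, continuity_2d_pt P a b.
Proof.
  intros HL HP a b eps. pose proof (cond_pos eps).
  assert (Hd : 0 < eps / (2 * L)) by (apply Rdiv_lt_0_compat; lra).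
  exists (mkposreal _ Hd). intros u v Hu Hv. simpl in Hu, Hv.
  eapply Rle_lt_trans; [apply HP|].
  apply (Rmult_lt_compat_l L) in Hu, Hv; auto.
  replace (L * (eps / (2 * L))) with (eps / 2) in Hu, Hv by (field; lra). lra.
Qed.

(* F need not be globally Lipschitz; F o clamp M is, and the a priori bound on the solutions
   makes the truncation harmless. *)
Definition clamp (M u : R) : R := Rmax (- M) (Rmin M u).

Lemma clamp_bound (M u : R) : 0 <= M -> - M <= clamp M u <= M.
Proof. intros HM. unfold clamp, Rmax, Rmin. repeat destruct Rle_dec; lra. Qed.

Lemma clamp_id (M u : R) : Rabs u <= M -> clamp M u = u.
Proof.
  intros H. apply Rabs_le_between in H. unfold clamp, Rmax, Rmin. repeat destruct Rle_dec; lra.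
Qed.

Lemma clamp_contract (M u v : R) : 0 <= M -> Rabs (clamp M u - clamp M v) <= Rabs (u - v).
Proof.
  intros HM. unfold clamp, Rmax, Rmin, Rabs.
  repeat destruct Rle_dec; repeat destruct Rcase_abs; lra.
Qed.

Lemma int_from_0_clamp_lipschitz (f : R -> R) (M : R) : 0 <= M -> (forall t, continuous f t) ->
  exists L, 0 < L /\
  forall u v, Rabs (int_from_0 f (clamp M u) - int_from_0 f (clamp M v)) <= L * Rabs (u - v).
Proof.
  intros HM Hf.
  destruct (continuous_le_max (fun t => Rabs (f t)) (- M) M) as [s Hs];
    [lra | intros; solve_continuous |].
  (* The added 1 keeps the constant positive even if f vanishes on [-M, M]. *)
  exists (Rabs (f s) + 1). split; [pose proof (Rabs_pos (f s)); lra|].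
  intros u v.
  destruct (MVT_gen (int_from_0 f) (clamp M v) (clamp M u) f) as (c & Hc & E).
  - intros; now apply is_derive_int_from_0.
  - intros; now apply continuity_pt_filterlim, continuous_int_from_0.
  - rewrite E, Rabs_mult.
    assert (Hcb : - M <= c <= M).
    { pose proof (clamp_bound M u HM). pose proof (clamp_bound M v HM).
      unfold Rmin, Rmax in Hc. repeat destruct Rle_dec in Hc; lra. }
    specialize (Hs c Hcb). apply Rmult_le_compat; try apply Rabs_pos; [lra|].
    now apply clamp_contract.
Qed.

Lemma drift_le (n : nat) (G e : R -> R) (K1 K2 : R) : (1 <= n)%nat ->
  (forall u, Rabs (G u) <= K1) -> (forall t, Rabs (e t) <= K2) ->
  forall x t, Rabs (drift_cos n G e x t) <= K1 + K2 /\ Rabs (drift_sin n G e x t) <= K1 + K2.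
Proof.
  intros hn HG He x t. assert (Hn : 1 <= INR n) by (apply (le_INR 1); lia).
  assert (H : forall c s, -1 <= c <= 1 -> -1 <= s <= 1 ->
    Rabs (G (x t) * c) + Rabs (/ INR n * (e t * s)) <= K1 + K2).
  { intros c s Hc Hs. apply Rabs_le in Hc, Hs. specialize (HG (x t)). specialize (He t).
    rewrite !Rabs_mult. apply Rplus_le_compat.
    - rewrite <- (Rmult_1_r K1). apply Rmult_le_compat; auto using Rabs_pos.
    - assert (0 < / INR n) by (apply Rinv_0_lt_compat; lra).
      assert (/ INR n <= 1) by (rewrite <- Rinv_1; apply Rinv_le_contravar; lra).
      rewrite (Rabs_right (/ INR n)) by lra.
      rewrite <- (Rmult_1_l K2), <- (Rmult_1_r (1 * K2)), Rmult_assoc.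
      pose proof (Rabs_pos (e t)). pose proof (Rabs_pos s).
      repeat apply Rmult_le_compat; auto using Rabs_pos; try lra.
      apply Rmult_le_pos; auto. }
  unfold drift_cos, drift_sin. split.
  - unfold Rminus. eapply Rle_trans; [apply Rabs_triang|]. rewrite !Rabs_Ropp.
    apply H; [apply COS_bound | apply SIN_bound].
  - eapply Rle_trans; [apply Rabs_triang|]. rewrite !Rabs_Ropp.
    apply H; [apply SIN_bound | apply COS_bound].
Qed.

(** Each of the two coordinates drifts by at most 2 pi K within a period, however large (a, b)
    is. *)
Lemma picard_near_wave (n : nat) (G e x : R -> R) (a b K t : R) :
  (forall t, continuous G t) -> (forall t, continuous e t) -> (forall t, continuous x t) ->
  (forall t, Rabs (drift_cos n G e x t) <= K /\ Rabs (drift_sin n G e x t) <= K) ->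
  0 <= t <= 2 * PI -> Rabs (picard n G e a b x t - wave n a b t) <= 4 * PI * K.
Proof.
  intros HG He Hx HK Ht. destruct (continuous_drift n G e x HG He Hx) as [Cx Sx].
  assert (HK0 : 0 <= K).
  { destruct (HK 0) as [H _]. pose proof (Rabs_pos (drift_cos n G e x 0)). lra. }
  assert (H : forall g, (forall t, continuous g t) -> (forall t, Rabs (g t) <= K) ->
    Rabs (RInt g 0 t) <= 2 * PI * K).
  { intros g Hg Hb. apply Rle_trans with ((t - 0) * K).
    - apply abs_RInt_le_const; [lra | now apply ex_RInt_cont | auto].
    - apply Rmult_le_compat_r; lra. }
  unfold picard. rewrite wave_minus. eapply Rle_trans; [apply Rabs_wave_le|].
  pose proof (H _ Cx (fun t => proj1 (HK t))). pose proof (H _ Sx (fun t => proj2 (HK t))).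
  rewrite !Rplus_minus_l. lra.
Qed.

(** * Sufficiency: inward displacement on a large circle *)

(** The inner product of the initial value with its displacement: the G-parts of the drift recombine
    into the unperturbed wave through (a, b), and the forcing leaves its Fourier coefficients. *)
Lemma radial_displacement (n : nat) (G e x : R -> R) (a b : R) :
  (forall t, continuous G t) -> (forall t, continuous e t) -> (forall t, continuous x t) ->
  a * RInt (drift_cos n G e x) 0 (2 * PI) + b * RInt (drift_sin n G e x) 0 (2 * PI) =
  / INR n * (cos_coeff e n * b + - sin_coeff e n * a)
  - RInt (fun t => G (x t) * wave n a b t) 0 (2 * PI).
Proof.
  intros HG He Hx. destruct (continuous_drift n G e x HG He Hx) as [Cx Sx].
  pose proof (continuous_wave n a b) as Hw.
  assert (E : RInt (fun t => a * drift_cos n G e x t + b * drift_sin n G e x t + G (x t) * wave n a b t) 0 (2 * PI)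
    = RInt (fun t => / INR n * (b * (e t * cos (INR n * t)) - a * (e t * sin (INR n * t)))) 0 (2 * PI)).
  { apply RInt_ext. intros t _. unfold drift_cos, drift_sin, wave. Rring. }
  rewrite RInt_Rplus, RInt_Rplus, !RInt_Rscal, RInt_Rminus, !RInt_Rscal in E
    by (intros; solve_continuous).
  unfold cos_coeff, sin_coeff. to_R. lra.
Qed.

Lemma resonance_sufficient (n : nat) (f e : R -> R) (Fp Fm : R) : (1 <= n)%nat ->
  (forall t, continuous f t) -> (forall t, continuous e t) -> periodic_2PI e ->
  is_lim (int_from_0 f) p_infty Fp -> is_lim (int_from_0 f) m_infty Fm ->
  (forall y, Fm < int_from_0 f y < Fp) ->
  sqrt (cos_coeff e n ^ 2 + sin_coeff e n ^ 2) < 2 * INR n * (Fp - Fm) ->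
  exists x, periodic_solution n f e x.
Proof.
  intros hn Hf He Hper Hlp Hlm Hb Hres. pose proof PI_RGT_0.
  assert (Hn : 0 < INR n) by (apply lt_0_INR; lia).
  set (F := int_from_0 f) in *.
  assert (CF : forall t, continuous F t) by (intros; now apply continuous_int_from_0).
  destruct (periodic_2PI_bounded e He Hper) as [Ke HKe].
  set (K := Rmax (Rabs Fp) (Rabs Fm) + Ke).
  (* The bound is uniform in the truncation level, as that level is chosen below in terms of [K]. *)
  assert (HK : forall M x t, let G := fun u => F (clamp M u) in
    Rabs (drift_cos n G e x t) <= K /\ Rabs (drift_sin n G e x t) <= K).
  { intros M. simpl. apply drift_le; auto. intros u. specialize (Hb (clamp M u)).
    pose proof (Rle_abs Fp). pose proof (Rle_abs (- Fm)) as H1. rewrite Rabs_Ropp in H1.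
    pose proof (Rmax_l (Rabs Fp) (Rabs Fm)). pose proof (Rmax_r (Rabs Fp) (Rabs Fm)).
    apply Rabs_le. lra. }
  assert (HK0 : 0 <= K).
  { destruct (HK 0 (fun _ => 0) 0) as [H1 _]. eapply Rle_trans; [apply Rabs_pos | exact H1]. }
  set (A := cos_coeff e n) in *. set (B := sin_coeff e n) in *.
  set (rho := sqrt (A ^ 2 + B ^ 2)) in *.
  (* The available margin is 8 eps; the lower bound on the integral consumes 4 eps of it. *)
  set (eps := (2 * (Fp - Fm) - / INR n * rho) / 8).
  assert (Heps : 0 < eps).
  { apply (Rmult_lt_compat_l (/ INR n)) in Hres; [|now apply Rinv_0_lt_compat].
    replace (/ INR n * (2 * INR n * (Fp - Fm))) with (2 * (Fp - Fm)) in Hres by (field; lra).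
    unfold eps; lra. }
  destruct (resonance_lower_bound n F Fp Fm eps (4 * PI * K) hn CF Hlp Hlm Hb Heps) as (C & HC0 & HC).
  { apply Rmult_le_pos; lra. }
  (* The remaining 4 eps, times r, equals C + 1 and makes the radial displacement at most -1 on the
     circle. *)
  set (r := (C + 1) / (4 * eps)).
  assert (Hr : 0 < r) by (apply Rdiv_lt_0_compat; lra).
  (* In the disc the wave is at most |a| + |b| <= 2 r, and x stays within 4 pi K of it over one
     period. *)
  set (M := 2 * r + 4 * PI * K).
  assert (HM : 0 <= M) by (unfold M; assert (0 <= 4 * PI * K) by (apply Rmult_le_pos; lra); lra).
  destruct (int_from_0_clamp_lipschitz f M HM Hf) as (L & HL & HGL). fold F in HGL.
  set (G := fun u => F (clamp M u)).
  assert (CG : forall t, continuous G t) by (apply (lipschitz_continuous G L HL HGL)).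
  specialize (HK M). cbv zeta in HK. fold G in HK.
  (* A solution is chosen for every initial value (a, b); stability makes the choice Lipschitz in
     (a, b). *)
  destruct (IndefiniteDescription.functional_choice
    (fun (p : R * R) x => (forall t, continuous x t) /\ forall t, picard n G e (fst p) (snd p) x t = x t))
    as [X HX].
  { intros p. apply (picard_fixed_point n G e L K HL CG He HGL HK). }
  assert (CX : forall a b t, continuous (X (a, b)) t) by (intros a b; apply (HX (a, b))).
  assert (EX : forall a b t, picard n G e a b (X (a, b)) t = X (a, b) t)
    by (intros a b; apply (HX (a, b))).
  set (P := fun a b => RInt (drift_cos n G e (X (a, b))) 0 (2 * PI)).
  set (Q := fun a b => RInt (drift_sin n G e (X (a, b))) 0 (2 * PI)).
  assert (Hnear : forall a b t, 0 <= t <= 2 * PI -> Rabs (X (a, b) t - wave n a b t) <= 4 * PI * K).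
  { intros a b t Ht. rewrite <- EX. apply picard_near_wave; auto. }
  assert (HXM : forall a b t, sqrt (a ^ 2 + b ^ 2) <= r -> 0 <= t <= 2 * PI -> Rabs (X (a, b) t) <= M).
  { intros a b t Hab Ht. specialize (Hnear a b t Ht).
    assert (Rabs a <= r).
    { eapply Rle_trans; [|apply Hab]. rewrite <- sqrt_Rsqr_abs. apply sqrt_le_1_alt. unfold Rsqr; nra. }
    assert (Rabs b <= r).
    { eapply Rle_trans; [|apply Hab]. rewrite <- sqrt_Rsqr_abs. apply sqrt_le_1_alt. unfold Rsqr; nra. }
    pose proof (Rabs_wave_le n a b t).
    replace (X (a, b) t) with ((X (a, b) t - wave n a b t) + wave n a b t) by ring.
    eapply Rle_trans; [apply Rabs_triang|]. unfold M. lra. }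
  assert (Hlip : forall a b a' b',
    Rabs (P a b - P a' b') <= flow_weight L (2 * PI) / 2 * (Rabs (a - a') + Rabs (b - b')) /\
    Rabs (Q a b - Q a' b') <= flow_weight L (2 * PI) / 2 * (Rabs (a - a') + Rabs (b - b'))).
  { intros a b a' b'. set (d := Rabs (a - a') + Rabs (b - b')).
    replace (flow_weight L (2 * PI) / 2 * d) with (2 * d / 4 * flow_weight L (2 * PI)) by field.
    apply (RInt_drift_minus_le n G e L HL CG He HGL (X (a, b)) (X (a', b')) (2 * d) (2 * PI)
      (CX a b) (CX a' b')).
    - unfold d. pose proof (Rabs_pos (a - a')). pose proof (Rabs_pos (b - b')). lra.
    - apply (picard_fixed_point_stable n G e L K HL CG He HGL HK a b a' b' _ _
        (CX a b) (CX a' b') (EX a b) (EX a' b')). }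
  assert (HW : 0 < flow_weight L (2 * PI) / 2)
    by (pose proof (flow_weight_ge_1 L HL (2 * PI)); lra).
  destruct (inward_zero r (2 * PI * K) P Q) as (a & b & Hab & HP & HQ); auto.
  - apply (lipschitz_continuity_2d_pt P _ HW (fun a b a' b' => proj1 (Hlip a b a' b'))).
  - apply (lipschitz_continuity_2d_pt Q _ HW (fun a b a' b' => proj2 (Hlip a b a' b'))).
  - intros a b. destruct (continuous_drift n G e (X (a, b)) CG He (CX a b)) as [Cx Sx].
    replace (2 * PI * K) with ((2 * PI - 0) * K) by ring.
    split; (apply abs_RInt_le_const; [lra | now apply ex_RInt_cont | intros; apply HK]).
  - intros a b Hab. unfold P, Q. rewrite radial_displacement by auto. fold A B.
    specialize (HC a b (X (a, b)) (CX a b) (Hnear a b)). rewrite Hab in HC.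
    (* The lower bound must be applied to F itself: the truncation tends to F(M) and F(-M), not to
       the limits of F. *)
    rewrite (RInt_ext _ (fun t => F (X (a, b) t) * wave n a b t)).
    2: { intros t. rewrite Rmin_left, Rmax_right by lra. intros Ht. unfold G.
         rewrite clamp_id; [reflexivity|]. apply HXM; lra. }
    pose proof (cauchy_schwarz_2 A (- B) b a) as Hcs.
    replace (A ^ 2 + (- B) ^ 2) with (A ^ 2 + B ^ 2) in Hcs by ring.
    replace (b ^ 2 + a ^ 2) with (a ^ 2 + b ^ 2) in Hcs by ring.
    fold rho in Hcs. rewrite Hab in Hcs.
    apply (Rmult_le_compat_l (/ INR n)) in Hcs; [|apply Rlt_le, Rinv_0_lt_compat; lra].
    assert (E : 4 * eps * r = C + 1) by (unfold r; field; lra).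
    assert (E' : / INR n * (rho * r) = 2 * (Fp - Fm) * r - 8 * eps * r) by (unfold eps; field; lra).
    eapply Rle_lt_trans; [apply Rplus_le_compat; [exact Hcs | apply Ropp_le_contravar, HC]|].
    rewrite E'. lra.
  - exists (X (a, b)).
    assert (Hp : periodic_2PI (X (a, b))).
    { apply (picard_fixed_point_periodic n G e L K HL CG He HGL HK a b); auto. }
    (* The a priori bound holds on one period only; periodicity, already proved for the truncated
       equation, extends it to all times and removes the truncation. *)
    assert (HFG : forall t, G (X (a, b) t) = F (X (a, b) t)).
    { intros t. unfold G. rewrite clamp_id; auto.
      destruct (periodic_2PI_reduce t) as (s & Hs & Es). rewrite <- (Es _ Hp). now apply HXM. }
    assert (EF : forall t, picard n F e a b (X (a, b)) t = X (a, b) t).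
    { intros t. rewrite <- EX. unfold picard. f_equal; f_equal; apply RInt_ext; intros s _;
        unfold drift_cos, drift_sin; now rewrite HFG. }
    destruct (picard_fixed_point_solution n f e _ a b hn Hf He (CX a b) EF) as [H1 H2].
    repeat split; auto; apply H1.
Qed.

Theorem theorem1p1 (n : nat) (hn : (1 <= n)%nat)
  (f : R -> R) (hf : forall x : R, continuous f x)
  (e : R -> R) (he : forall t : R, continuous e t) (hper : periodic_2PI e)
  (Fpinf Fminf : R)
  (hFp : is_lim (int_from_0 f) p_infty (Finite Fpinf))
  (hFm : is_lim (int_from_0 f) m_infty (Finite Fminf))
  (hF : forall x : R, Fminf < int_from_0 f x < Fpinf) :
  sqrt (cos_coeff e n ^ 2 + sin_coeff e n ^ 2) < 2 * INR n * (Fpinf - Fminf)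
  <-> exists x : R -> R, periodic_solution n f e x.
Proof.
  split.
  - now apply resonance_sufficient.
  - intros [x Hx]. now apply (resonance_necessary n f e x).
Qed.
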